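(* Let $n\geq 12$, $\sigma\in[\tfrac12,1)$, and let $\hat T$ be an $A_\sigma$-minimizer graph in $\mathcal{G}_{n,n-4}$. Put $t=\lfloor (n-7)/4\rfloor$ and $\ell'=(n-7)-4t\in\{0,1,2,3\}$. Then $\hat T$ is isomorphic to $T_1(a,b,c,d)$ or $T_2(a,b,c,d)$ for some nonnegative integers with $a+b+c+d=n-7$. Moreover $\hat T$ is isomorphic to one of the following graphs (with all entries nonnegative): if $\ell'=0$: $T_1$ with $(a,b,c,d)\in\{(t-1,t+1,t+1,t-1),(t,t+1,t+1,t-2),(t,t,t+1,t-1),(t+1,t+1,t+1,t-3)\}$, or $T_2$ with $(a,b,c,d)\in\{(t-1,t,t,t+1),(t,t-1,t,t+1),(t,t,t-1,t+1),(t,t,t,t),(t+1,t-2,t,t+1),(t+1,t-1,t-1,t+1)\}$; if $\ell'=1$: $T_1$ with $(a,b,c,d)\in\{(t,t+1,t+1,t-1),(t+1,t+1,t+1,t-2)\}$, or $T_2$ with $(a,b,c,d)\in\{(t,t,t,t+1),(t+1,t-1,t,t+1)\}$; if $\ell'=2$: $T_1(t+1,t+1,t+1,t-1)$ or $T_2(t+1,t,t,t+1)$; if $\ell'=3$: $T_1$ with $(a,b,c,d)\in\{(t-1,t+2,t+2,t),(t,t+2,t+2,t-1),(t,t+1,t+2,t),(t+1,t+2,t+2,t-2),(t+1,t+1,t+2,t-1),(t+1,t+1,t+1,t),(t+2,t+2,t+2,t-3)\}$, or $T_2$ with $(a,b,c,d)\in\{(t-1,t+1,t+1,t+2),(t,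t,t+1,t+2),(t,t+1,t,t+2),(t,t+1,t+1,t+1),(t+1,t+1,t-1,t+2),(t+1,t-1,t+1,t+2),(t+1,t,t,t+2),(t+1,t,t+1,t+1),(t+2,t-2,t+1,t+2),(t+2,t-1,t,t+2)\}$.
   Context: All graphs are finite, simple and connected. $A_\sigma(G)=\sigma D(G)+(1-\sigma)A(G)$ where $A(G)$ is the adjacency matrix and $D(G)$ the diagonal degree matrix; $\lambda_\sigma(G)$ is its largest eigenvalue. $\mathcal{G}_{n,\alpha}$ is the family of connected $n$-vertex graphs with independence number $\alpha$; an $A_\sigma$-minimizer graph attains the minimum of $\lambda_\sigma$ over it. The subdivision graph $S(T)$ of a tree $T$ is obtained by subdividing every edge once. $T_1(a,b,c,d)$: take the star $K_{1,3}$ with leaves $w_1,w_2,w_3$ and center $w_4$, form $S(K_{1,3})$, and attach $a,b,c,d$ pendant edges to $w_1,w_2,w_3,w_4$ respectively. $T_2(a,b,c,d)$: take the path $P_4=u_1u_2u_3u_4$, form $S(P_4)$, and attach $a,b,c,d$ pendant edges to $u_1,u_2,u_3,u_4$ respectively. *)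

(* Defs.v *)
From HB Require Import structures.
From mathcomp Require Import all_boot all_order all_algebra.
From mathcomp Require Import reals.

Set Implicit Arguments.
Unset Strict Implicit.
Unset Printing Implicit Defensive.

Import Order.TTheory GRing.Theory Num.Theory.

Record sgraph := SGraph {
  svertex :> finType;
  sedge : rel svertex;
  sedge_sym : symmetric sedge;
  sedge_irr : irreflexive sedge }.

Arguments sedge {s}.

Definition giso (G H : sgraph) : Prop :=
  exists2 f : G -> H, bijective f & forall x y, sedge (f x) (f y) = sedge x y.

Definition gconnected (G : sgraph) : Prop :=
  0 < #|G| /\ forall x y : G, connect sedge x y.

Definition gdeg (G : sgraph) (x : G) : nat := #|[set y | sedge x y]|.

Definition independent (G : sgraph) (S : {set G}) : bool :=
  [forall x in S, forall y in S, ~~ sedge x y].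

Definition independence_number (G : sgraph) : nat :=
  \max_(S : {set G} | independent S) #|S|.

Definition in_family (n alpha : nat) (G : sgraph) : Prop :=
  [/\ #|G| = n, gconnected G & independence_number G = alpha].

Section Spectral.
Local Open Scope ring_scope.
Variable R : realType.

(* Rows and columns are indexed by the position of a vertex in [enum G]. *)
Definition adj_mx (G : sgraph) : 'M[R]_#|G| :=
  \matrix_(i, j) (sedge (enum_val i) (enum_val j))%:R.

Definition deg_mx (G : sgraph) : 'M[R]_#|G| :=
  diag_mx (\row_i (gdeg (enum_val i))%:R).

Definition A_mx (sigma : R) (G : sgraph) : 'M[R]_#|G| :=
  sigma *: deg_mx G + (1 - sigma) *: adj_mx G.

Definition largest_eigenvalue m (A : 'M[R]_m) (l : R) : Prop :=
  eigenvalue A l /\ forall mu : R, eigenvalue A mu -> mu <= l.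

(* [A_mx sigma H] is real symmetric of positive order when [H] is connected,
   so it has exactly one largest eigenvalue. *)
Definition A_minimizer (sigma : R) (n alpha : nat) (G : sgraph) : Prop :=
  in_family n alpha G /\
  exists2 l, largest_eigenvalue (A_mx sigma G) l &
    forall (H : sgraph) (m : R), in_family n alpha H ->
      largest_eigenvalue (A_mx sigma H) m -> l <= m.

End Spectral.

(* Subdivision graph: the new vertices are the edges of [G], viewed as
   two-element sets of vertices. *)
Section Subdivision.
Variable G : sgraph.

Definition is_edge (e : {set G}) : bool :=
  [exists x, exists y, sedge x y && (e == [set x; y])].

Definition subdiv_vertex : finType := (G + {e : {set G} | is_edge e})%type.

Definition subdiv_edge : rel subdiv_vertex := fun u v =>
  match u, v with
  | inl x, inr e | inr e, inl x => x \in val e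
  | _, _ => false
  end.

Lemma subdiv_edge_sym : symmetric subdiv_edge.
Proof. by case=> [x|e] [y|f]. Qed.

Lemma subdiv_edge_irr : irreflexive subdiv_edge.
Proof. by case. Qed.

Definition subdivision : sgraph := SGraph subdiv_edge_sym subdiv_edge_irr.

End Subdivision.

(* [p x] pendant edges are attached to each vertex [x] of [G]. *)
Section Pendants.
Variables (G : sgraph) (p : G -> nat).

Definition pendant_vertex : finType := (G + {x : G & 'I_(p x)})%type.

Definition pendant_edge : rel pendant_vertex := fun u v =>
  match u, v with
  | inl x, inl y => sedge x y
  | inl x, inr q | inr q, inl x => tag q == x
  | inr _, inr _ => false
  end.

Lemma pendant_edge_sym : symmetric pendant_edge.
Proof. by case=> [x|e] [y|f] //=; apply: sedge_sym. Qed.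

Lemma pendant_edge_irr : irreflexive pendant_edge.
Proof. by case=> [x|e] //=; apply: sedge_irr. Qed.

Definition attach_pendants : sgraph :=
  SGraph pendant_edge_sym pendant_edge_irr.

End Pendants.

(* The vertices w_1, ..., w_4 (resp. u_1, ..., u_4) are the ordinals 0, ..., 3;
   the center w_4 of the star is thus the ordinal 3. *)
Definition star_edge : rel 'I_4 := fun i j => (i == 3 :> nat) (+) (j == 3 :> nat).

Lemma star_edge_sym : symmetric star_edge.
Proof. by move=> i j; rewrite /star_edge addbC. Qed.

Lemma star_edge_irr : irreflexive star_edge.
Proof. by move=> i; rewrite /star_edge addbb. Qed.

Definition K13 : sgraph := SGraph star_edge_sym star_edge_irr.

Definition path_edge : rel 'I_4 := fun i j => (i.+1 == j) || (j.+1 == i).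

Lemma path_edge_sym : symmetric path_edge.
Proof. by move=> i j; rewrite /path_edge orbC. Qed.

Lemma path_edge_irr : irreflexive path_edge.
Proof. by move=> i; rewrite /path_edge orbb gtn_eqF. Qed.

Definition P4 : sgraph := SGraph path_edge_sym path_edge_irr.

(* Pendant edges are attached to the original vertices only. *)
Definition pendant_count (G : sgraph) (f : G -> nat) (v : subdivision G) : nat :=
  match v with inl x => f x | inr _ => 0 end.

Definition T1 (a b c d : nat) : sgraph :=
  attach_pendants
    (@pendant_count K13 (fun i : 'I_4 => nth 0 [:: a; b; c; d] i)).

Definition T2 (a b c d : nat) : sgraph :=
  attach_pendants
    (@pendant_count P4 (fun i : 'I_4 => nth 0 [:: a; b; c; d] i)).

(* The quadruples are integer-valued, so that t - 1, t - 2, t - 3 are genuine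
   differences; those with a negative entry are discarded because a, b, c, d
   are natural numbers. *)
Definition giso_among (T : nat -> nat -> nat -> nat -> sgraph)
    (s : seq (int * int * int * int)) (G : sgraph) : Prop :=
  exists a b c d : nat, (Posz a, Posz b, Posz c, Posz d) \in s /\ giso G (T a b c d).

(* Main.v *)
(** Let [x] be the Perron vector of a minimizer [G]. The complement [C] of a
    maximum independent set has four vertices. Call two of them linked if they
    are adjacent or have a common neighbour outside [C]: since [G] is connected,
    the links contain a spanning tree [K] of [C], a star or a path, and [K] can be
    chosen to respect the degree of the vertex of [C] of least degree. Let [H] be
    [K] subdivided, with pendant edges, of the same order as [G]. The restriction
    of [x] to [C] extends to a test vector on [H], because each neighbour of a
    vertex of [C] contributes at least as much as a pendant vertex together with
    the tree edges that it realizes. By minimality no defect can be strict, so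
    every vertex outside [C] is pendant or subdivides an edge of [K], and [G] is
    isomorphic to [H]. Testing a subdivided path with a vector constant on the
    vertices of the path shows that all degrees of [G] are at most
    (n - 1) / 4 rounded up, which leaves only the listed quadruples. *)

(* The accounting is by degrees. The vertices of [K] have degree sum n - 7 + 6 = n - 1 in [H]. Those
   of [C] have at least that in [G], with a bonus for edges of [G] inside [C]. Pendant edges can
   thus be dealt out without exceeding the degrees of [G], provided [K] itself fits. Here the degree
   bound is used a first time: for n >= 12 every vertex of [C] other than a chosen one of least
   degree has degree at least 3, so only the chosen one restricts [K].

   Neighbours are compared through the weights (1 - s)^2 / (l - k s) of a vertex of degree k outside
   [C]. They are convex in k, so a vertex realizing several tree edges at once pays for a pendant
   vertex and for each of these edges, strictly when k >= 3. A neighbour inside [C] of degree at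
   most 2 need not be able to pay for a tree edge; one unit of degree is then withheld from the
   pendant edges, and the bonus covers it. The assumption s >= 1/2 enters as 1 - s <= s. *)
Require Import Defs.
From HB Require Import structures.
From mathcomp Require Import perm boolp classical_sets topology normedtype derive.
From mathcomp Require Import all_boot all_order all_algebra.
From mathcomp Require Import reals.
From mathcomp Require Import zify ring lra.

Set Implicit Arguments.
Unset Strict Implicit.
Unset Printing Implicit Defensive.

Import Order.TTheory GRing.Theory Num.Theory.
Import numFieldNormedType.Exports.

Local Open Scope ring_scope.

(** * The Perron vector of a symmetric nonnegative matrix *)

Section SymmetricMatrix.
Local Open Scope classical_set_scope.

Variables (R : realType) (n : nat) (A : 'M[R]_n).
Hypothesis A_sym : A^T = A.

Let cvg_sum (T I : Type) (F : set_system T) {FF : Filter F}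
    (r : seq I) (f : I -> T -> R) (l : I -> R) :
  (forall i, f i x @[x --> F] --> l i) ->
  \sum_(i <- r) f i x @[x --> F] --> \sum_(i <- r) l i.
Proof.
move=> fl; elim: r => [|i r IH].
  by rewrite big_nil; under eq_fun do rewrite big_nil; apply: cvg_cst.
by rewrite big_cons; under eq_fun do rewrite big_cons; apply: cvgD.
Qed.

Let form (u w : 'rV[R]_n) : R := (u *m A *m w^T) 0 0.
Let sqnorm (u : 'rV[R]_n) : R := \sum_i u 0 i ^+ 2.

Let formE u w : form u w = \sum_j (\sum_i u 0 i * A i j) * w 0 j.
Proof. by rewrite /form mxE; apply: eq_bigr => j _; rewrite !mxE. Qed.

Let formC u w : form u w = form w u.
Proof.
have -> : form w u = (w *m A *m u^T) 0 0 by [].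
have -> : w *m A *m u^T = (u *m A *m w^T)^T by rewrite !trmx_mul trmxK A_sym mulmxA.
by rewrite mxE.
Qed.

Let sqnormE u : sqnorm u = (u *m u^T) 0 0.
Proof. by rewrite mxE; apply: eq_bigr => i _; rewrite mxE expr2. Qed.

Let sqnorm_eq0 u : sqnorm u = 0 -> u = 0.
Proof.
move=> u0; apply/rowP => i; rewrite mxE; apply/eqP; rewrite -sqrf_eq0.
have /psumr_eq0P -> // := u0; by move=> j _; apply: sqr_ge0.
Qed.

Let form_continuous : continuous (fun u => form u u).
Proof.
move=> u; rewrite /continuous_at formE; under eq_fun do rewrite formE.
apply: (cvg_sum (FF := nbhs_filter u)) => j; apply: cvgM; last exact: coord_continuous.
by apply: (cvg_sum (FF := nbhs_filter u)) => i; apply: cvgM;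
  [exact: coord_continuous|exact: cvg_cst].
Qed.

Let sqnorm_continuous : continuous sqnorm.
Proof.
by move=> u; apply: (cvg_sum (FF := nbhs_filter u)) => i; apply: cvgM; exact: coord_continuous.
Qed.

Lemma form_maximizer : (0 < n)%N ->
  exists2 u, sqnorm u = 1 & forall w, sqnorm w = 1 -> form w w <= form u u.
Proof.
move=> n_gt0.
pose S : set 'rV[R]_n := [set u | sqnorm u = 1].
have S0 : S !=set0.
  exists (delta_mx 0 (Ordinal n_gt0)); rewrite /S /= /sqnorm.
  rewrite (bigD1 (Ordinal n_gt0)) //= big1 => [|i ne]; rewrite !mxE !eqxx.
    by rewrite expr1n addr0.
  by rewrite (negPf ne) expr0n.
have Sclosed : topology_structure.closed S.
  have [H _] := @continuous_closedP 'rV[R]_n R sqnorm.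
  exact: (H sqnorm_continuous _ (@closed_eq R 1)).
have cube : compact [set u : 'rV[R]_n | forall i, `[-1, 1]%classic (u ord0 i)].
  by apply: (@rV_compact R n (fun=> `[-1, 1]%classic)) => _; exact: segment_compact.
have Scompact : compact S.
  apply: (subclosed_compact Sclosed cube) => u Su i /=.
  rewrite in_itv /= -ler_norml -(@expr_le1 _ 2) // real_normK ?num_real //.
  rewrite -Su /sqnorm (bigD1 i) //= lerDl; apply: sumr_ge0 => j _; exact: sqr_ge0.
have [u] := EVT_max_rV S0 Scompact (continuous_subspaceT form_continuous).
by move=> /set_mem Su max; exists u => // w Sw; apply: max; apply: mem_set.
Qed.

Let form_le mu : (forall w, sqnorm w = 1 -> form w w <= mu) ->
  forall w, form w w <= mu * sqnorm w.
Proof.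
move=> le_mu w; have [/sqnorm_eq0 ->|w_neq0] := eqVneq (sqnorm w) 0.
  by rewrite /form !mul0mx mxE sqnormE mul0mx mxE mulr0.
have w_gt0 : 0 < sqnorm w.
  by rewrite lt_def w_neq0; apply: sumr_ge0 => i _; exact: sqr_ge0.
pose c := (Num.sqrt (sqnorm w))^-1.
have c2 : c * c = (sqnorm w)^-1 by rewrite -invfM -expr2 sqr_sqrtr // ltW.
have /le_mu : sqnorm (c *: w) = 1.
  by rewrite sqnormE linearZ /= -scalemxAl -scalemxAr scalerA mxE c2 -sqnormE mulVf.
rewrite /form linearZ /= -!scalemxAl -scalemxAr scalerA mxE c2.
by rewrite mulrC ler_pdivrMr.
Qed.

(** First-order condition: [mu * sqnorm w - form w w] is nonnegative and vanishes at [v]. Along the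
    residual [z = mu *: v - v *m A] its derivative at [v] is twice [sqnorm z], which must therefore
    be zero. *)
Let variation mu v : (forall w, form w w <= mu * sqnorm w) ->
  form v v = mu * sqnorm v -> v *m A = mu *: v.
Proof.
move=> le_mu max_v; apply/esym/eqP; rewrite -subr_eq0; apply/eqP.
have [z zE] : exists z, z = mu *: v - v *m A by eexists.
rewrite -zE; apply: sqnorm_eq0.
have dz : sqnorm z = mu * (v *m z^T) 0 0 - form v z.
  by rewrite sqnormE {1}zE mulmxBl -scalemxAl /form !mxE.
set b := sqnorm z in dz *; set a := mu * sqnorm z - form z z.
have a_ge0 : 0 <= a by rewrite subr_ge0.
have expand t : 0 <= (t * b) *+ 2 + t ^+ 2 * a.
  have eD (M N : 'M[R]_1) : (M + N) 0 0 = M 0 0 + N 0 0 by rewrite mxE.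
  have eZ c (M : 'M[R]_1) : (c *: M) 0 0 = c * M 0 0 by rewrite mxE.
  have trE : (v + t *: z)^T = v^T + t *: z^T by rewrite linearD linearZ.
  have /(_ (v + t *: z)) := le_mu; rewrite -subr_ge0.
  have -> : sqnorm (v + t *: z) =
      sqnorm v + (t * (v *m z^T) 0 0) *+ 2 + t ^+ 2 * sqnorm z.
    have zv : (z *m v^T) 0 0 = (v *m z^T) 0 0.
      by rewrite !mxE; apply: eq_bigr => i _; rewrite !mxE mulrC.
    rewrite !sqnormE trE !(mulmxDl, mulmxDr) -?(scalemxAl, scalemxAr).
    by rewrite !(eD, eZ) zv; ring.
  have -> : form (v + t *: z) (v + t *: z) =
      form v v + (t * form v z) *+ 2 + t ^+ 2 * form z z.
    have := formC z v; rewrite /form.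
    rewrite trE !(mulmxDl, mulmxDr) -?(scalemxAl, scalemxAr).
    by rewrite !(eD, eZ) => ->; ring.
  by rewrite max_v dz /a; congr (0 <= _); ring.
have b_ge0 : 0 <= b by apply: sumr_ge0 => i _; exact: sqr_ge0.
have a1 : 0 < a + 1 by rewrite ltr_wpDl.
(* For [a > 0] the minimum is at [- b / a]; the denominator [a + 1] also covers [a = 0], and the
   value is still negative unless [b = 0]. *)
have := expand (- b / (a + 1)).
have -> : (- b / (a + 1) * b) *+ 2 + (- b / (a + 1)) ^+ 2 * a =
    - (b ^+ 2 * ((a + 2) / (a + 1) ^+ 2)) by field; rewrite gt_eqF.
rewrite oppr_ge0 pmulr_lle0 => [|]; last first.
  by rewrite divr_gt0 ?exprn_gt0 // ltr_wpDl.
by move=> b2; apply/eqP; rewrite -sqrf_eq0 eq_le b2 sqr_ge0.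
Qed.

(** Replacing the entries of a maximizer by their absolute values does not decrease the form of a
    nonnegative matrix. Strict positivity is obtained later from connectedness. *)
Lemma Perron_vector : (0 < n)%N -> (forall i j, 0 <= A i j) ->
  exists mu (v : 'rV_n), [/\ v != 0, forall i, 0 <= v 0 i, v *m A = mu *: v &
    forall nu, eigenvalue A nu -> nu <= mu].
Proof.
move=> n_gt0 A_ge0; have [u u1 u_max] := form_maximizer n_gt0.
pose mu := form u u; pose v := map_mx Num.norm u : 'rV_n.
have le_mu := form_le u_max.
have v1 : sqnorm v = 1.
  by rewrite -u1; apply: eq_bigr => i _; rewrite mxE real_normK ?num_real.
have max_v : form v v = mu * sqnorm v.
  apply/eqP; rewrite eq_le le_mu v1 mulr1 /mu !formE.
  apply: ler_sum => j _; rewrite mxE (le_trans (ler_norm _)) // normrM.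
  rewrite ler_wpM2r // (le_trans (ler_norm_sum _ _ _)) // ler_sum // => i _.
  by rewrite mxE normrM (ger0_norm (A_ge0 _ _)).
exists mu, v; split=> [|i||nu /eigenvalueP[w wA w_neq0]].
- by apply: contra_eq_neq v1 => ->; rewrite sqnormE mul0mx mxE eq_sym oner_eq0.
- by rewrite mxE.
- exact: variation.
have := le_mu w; rewrite {1}/form wA -scalemxAl mxE -sqnormE ler_pM2r //.
rewrite lt_def; apply/andP; split; last by apply: sumr_ge0 => i _; exact: sqr_ge0.
by apply: contra_neq w_neq0; exact: sqnorm_eq0.
Qed.

End SymmetricMatrix.

(** * The operator of a graph on functions of its vertices *)

Section GraphOperator.
Variables (R : realType) (s : R).
Hypothesis s_bnd : 0 <= s < 1.

(** The degree term is spread over the neighbours, so that on a subdivided tree the value splits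
    over the kinds of neighbours without computing degrees. *)
Definition A_op (G : sgraph) (y : G -> R) (x : G) : R :=
  \sum_(z | sedge x z) (s * y x + (1 - s) * y z).

Lemma A_opE (G : sgraph) (y : G -> R) x :
  A_op y x = s * (gdeg x)%:R * y x + (1 - s) * \sum_(z | sedge x z) y z.
Proof.
rewrite /A_op big_split /= sumr_const -mulr_sumr mulrAC.
by rewrite /gdeg cardsE mulr_natr.
Qed.

Lemma mulmx_A_mx (G : sgraph) (v : 'rV[R]_#|G|) j :
  (v *m A_mx s G) 0 j = A_op (fun x => v 0 (enum_rank x)) (enum_val j).
Proof.
rewrite A_opE enum_valK /A_mx mulmxDr -!scalemxAr /deg_mx mul_mx_diag !mxE.
congr (_ + _ * _); first by ring.
rewrite [RHS]big_mkcond (reindex _ (onW_bij _ (@enum_rank_bij G))) /=.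
apply: eq_bigr => z _; rewrite !mxE enum_rankK sedge_sym.
by case: ifP => _; rewrite ?mulr1 ?mulr0.
Qed.

Lemma A_mx_sym (G : sgraph) : (A_mx s G)^T = A_mx s G.
Proof.
apply/matrixP => i j; rewrite !mxE sedge_sym eq_sym.
by have [->|] := eqVneq i j.
Qed.

Lemma graph_Perron (G : sgraph) : gconnected G ->
  exists mu (y : G -> R), [/\ forall x, 0 < y x, forall x, A_op y x = mu * y x
    & largest_eigenvalue (A_mx s G) mu].
Proof.
move=> [G_gt0 G_conn]; have /andP[s_ge0 s_lt1] := s_bnd.
have [i j|mu [v [v_neq0 v_ge0 vA mu_max]]] := Perron_vector (A_mx_sym G) G_gt0.
  rewrite !mxE; apply: addr_ge0; apply: mulr_ge0 => //.
    by case: eqP => _; rewrite ?mulr1n ?mulr0n ?ler0n.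
  by rewrite subr_ge0 ltW.
pose y x := v 0 (enum_rank x).
have y_ge0 x : 0 <= y x by exact: v_ge0.
have yE x : A_op y x = mu * y x.
  by rewrite -[x]enum_rankK -mulmx_A_mx vA mxE /y enum_rankK.
(* At a zero of [y] the eigenvalue equation annihilates a sum of nonnegative terms, so zeros spread
   along edges and, by connectedness, everywhere. *)
have y0_edge x z : sedge x z -> y x = 0 -> y z = 0.
  move=> xz y0; have := yE x; rewrite /A_op y0 !mulr0.
  under eq_bigr do rewrite add0r.
  have term_ge0 w : 0 <= (1 - s) * y w by rewrite mulr_ge0 // subr_ge0 ltW.
  move=> /(psumr_eq0P (fun w _ => term_ge0 w))/(_ z xz)/eqP.
  by rewrite mulf_eq0 subr_eq0 gt_eqF //= => /eqP.
exists mu, y; split=> // [x|]; last by split=> //; apply/eigenvalueP; exists v.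
rewrite lt_def y_ge0 andbT; apply: contra_neq v_neq0 => y0.
apply/rowP => i; rewrite mxE -[i]enum_valK; change (y (enum_val i) = 0).
have /connectP[p] := G_conn x (enum_val i).
elim: p x y0 => [|z p IH] x y0 /=; first by move=> _ ->.
by case/andP=> xz; apply: IH; apply: y0_edge xz y0.
Qed.

Lemma A_op_sym (G : sgraph) (y z : G -> R) :
  \sum_x z x * A_op y x = \sum_x A_op z x * y x.
Proof.
under eq_bigr do rewrite A_opE mulrDr.
under [RHS]eq_bigr do rewrite A_opE mulrDl.
rewrite !big_split /=; congr (_ + _); first by apply: eq_bigr => x _; ring.
under eq_bigr do rewrite mulrCA mulr_sumr.
under [RHS]eq_bigr do rewrite -mulrA mulr_suml.
rewrite -!mulr_sumr; congr (_ * _); rewrite (exchange_big_dep predT) //=.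
by apply: eq_bigr => x _; apply: eq_bigl => w; rewrite sedge_sym.
Qed.

(* The Perron vector [z] of [H], paired with [y], turns the hypothesis
   [A_op y <= l y] into [m <= l] for the largest eigenvalue [m] of [H]; the
   minimality of [l] forces equality. *)
Lemma minimizer_Perron n a (G : sgraph) : A_minimizer s n a G ->
  exists l (x : G -> R), [/\ forall v, 0 < x v, forall v, A_op x v = l * x v &
    forall (H : sgraph) (y : H -> R), in_family n a H -> (forall u, 0 < y u) ->
      (forall u, A_op y u <= l * y u) -> forall u, A_op y u = l * y u].
Proof.
move=> [[_ G_conn _] [l [l_eig l_max] l_min]].
have [l' [x [x_gt0 xE [l'_eig l'_max]]]] := graph_Perron G_conn.
have ll' : l' = l by apply/le_anti/andP; split; [exact: l_max|exact: l'_max].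
exists l, x; split=> [||H y H_fam y_gt0 y_le u] //; first by rewrite -ll'.
have [_ H_conn _] := H_fam.
have [m [z [z_gt0 zE m_max]]] := graph_Perron H_conn.
have le_lm := l_min _ _ H_fam m_max.
have defect_ge0 w : 0 <= z w * (l * y w - A_op y w).
  by rewrite mulr_ge0 ?subr_ge0 // ltW.
have defect_le0 : \sum_w z w * (l * y w - A_op y w) <= 0.
  under eq_bigr do rewrite mulrBr.
  rewrite sumrB A_op_sym subr_le0; apply: ler_sum => w _.
  by rewrite zE mulrCA -mulrA ler_wpM2r // ltW // mulr_gt0.
have /psumr_eq0P h : \sum_w z w * (l * y w - A_op y w) = 0.
  by apply/le_anti; rewrite defect_le0 sumr_ge0.
have /eqP := h (fun w _ => defect_ge0 w) u isT.
by rewrite mulf_eq0 gt_eqF //= subr_eq0 => /eqP.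
Qed.

End GraphOperator.

(** * Subdivided graphs with pendant edges *)

Definition caterpillar (K : sgraph) (p : K -> nat) : sgraph :=
  attach_pendants (@pendant_count K p).

Section Caterpillar.
Variables (K : sgraph) (p : K -> nat).
Notation H := (caterpillar p).
Notation edge := {e : {set K} | @is_edge K e}.

Definition core (i : K) : H := inl (inl i).
Definition mid (e : edge) : H := inl (inr e).
Definition leaf (i : K) (k : 'I_(p i)) : H :=
  inr (existT (fun x : subdivision K => 'I_(pendant_count p x)) (inl i) k).

Variant caterpillar_spec : H -> Prop :=
| Core i : caterpillar_spec (core i)
| Mid e : caterpillar_spec (mid e)
| Leaf i k : caterpillar_spec (@leaf i k).

Lemma caterpillarP x : caterpillar_spec x.
Proof. by case: x => [[i|e]|[[i|e] k]]; [constructor|constructor|constructor|case: k]. Qed.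

Lemma edge_exists (i j : K) : sedge i j -> @is_edge K [set i; j].
Proof. by move=> ij; apply/existsP; exists i; apply/existsP; exists j; rewrite ij eqxx. Qed.

Lemma edgeP (e : edge) : exists i j : K, sedge i j /\ val e = [set i; j] :> {set K}.
Proof. by have /existsP[i /existsP[j /andP[ij /eqP ->]]] := valP e; exists i, j. Qed.

Lemma card_edge (e : edge) : #|val e| = 2%N.
Proof.
have [i [j [ij ->]]] := edgeP e; rewrite cards2.
by case: eqP ij => // <-; rewrite sedge_irr.
Qed.

Lemma big_edges (V : nmodType) i (F : {set K} -> V) :
  \sum_(e : edge | i \in val e) F (val e) = \sum_(j | sedge i j) F [set i; j].
Proof.
have inj : {in [set j | sedge i j] &, injective (fun j => [set i; j])}.
  move=> j k; rewrite !inE => ij _ eq_jk.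
  have : j \in [set i; k] by rewrite -eq_jk set22.
  by rewrite !inE => /orP[/eqP ji|/eqP //]; rewrite ji sedge_irr in ij.
transitivity (\sum_(e in [set [set i; j] | j in [set j | sedge i j]]) F e); last first.
  by rewrite big_imset //=; apply: eq_bigl => j; rewrite inE.
transitivity (\sum_(e : {set K} | @is_edge K e && (i \in e)) F e).
  symmetry; rewrite (reindex_omap (val : edge -> {set K}) insub) /=; last first.
    by move=> e /andP[eE _]; rewrite insubT.
  by apply: eq_bigl => e; rewrite valK eqxx andbT (valP e).
apply: eq_bigl => e; apply/andP/imsetP => [[/existsP[j /existsP[k]]]|[j]].
  case/andP=> jk /eqP->; rewrite !inE => /orP[]/eqP->.
    by exists k; rewrite ?inE.
  by exists j; rewrite ?inE 1?sedge_sym // setUC.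
by rewrite inE => ij ->; split; [exact: edge_exists|exact: set21].
Qed.

Lemma card_edges : (2 * #|{: edge}| = \sum_(i : K) gdeg i)%N.
Proof.
transitivity (\sum_(i : K) \sum_(e : edge | i \in val e) 1)%N.
  rewrite (exchange_big_dep predT) //= -[LHS]mulnC -sum_nat_const.
  by apply: eq_bigr => e _; rewrite sum1_card card_edge.
apply: eq_bigr => i _; rewrite /gdeg -sum1_card.
rewrite (@big_edges nat i (fun=> 1%N)); apply: eq_bigl => j; by rewrite inE.
Qed.

Lemma big_caterpillar (V : nmodType) (P : pred H) (F : H -> V) :
  \sum_(z | P z) F z = \sum_(i | P (core i)) F (core i) +
    \sum_(e | P (mid e)) F (mid e) + \sum_i \sum_(k | P (@leaf i k)) F (@leaf i k).
Proof.
rewrite big_mkcond big_sumType /= big_sumType /= -!big_mkcond /=; congr (_ + _); rewrite big_mkcond /=.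
rewrite (eq_bigr (fun z : {x : subdivision K & 'I_(pendant_count p x)} =>
  (fun x k => if P (inr (existT _ x k)) then F (inr (existT _ x k)) else 0)
  (tag z) (tagged z))); last by case=> [x k] _.
rewrite -(@sig_big_dep _ _ _ _ (fun x => 'I_(pendant_count p x) : finType)
  predT (fun _ => predT)
  (fun x k => if P (inr (existT _ x k)) then F (inr (existT _ x k)) else 0)) /=.
rewrite big_sumType /= [X in _ + X]big1 ?addr0 => [|e _]; last first.
  by rewrite big1 // => -[].
by apply: eq_bigr => i _; rewrite -big_mkcond.
Qed.

Lemma card_caterpillar : #|H| = (#|K| + #|{: edge}| + \sum_i p i)%N.
Proof.
rewrite !card_sum card_tagged sumnE big_map big_enum big_sumType /=.
rewrite [X in (_ + (_ + X))%N]big1 ?addn0 => [|e _]; last by rewrite card_ord.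
by congr (_ + _)%N; apply: eq_bigr => i _; rewrite card_ord.
Qed.

Lemma caterpillar_connected : gconnected K -> gconnected H.
Proof.
case=> K_gt0 K_conn; split.
  by rewrite card_caterpillar (leq_trans K_gt0) // -addnA leq_addr.
have csym : connect_sym (@sedge H) by apply: sym_connect_sym; exact: sedge_sym.
have core_core i j : connect sedge (core i) (core j).
  have /connectP[q] := K_conn i j; elim: q i => [|k q IH] i /=; first by move=> _ ->.
  case/andP=> ik /(IH k) {}IH /IH; apply: connect_trans.
  pose e : edge := exist _ [set i; k] (edge_exists ik).
  apply: (@connect_trans _ _ (mid e)); apply: connect1; rewrite /= !inE eqxx //.
  by rewrite orbT.
have core_any x : exists i, connect sedge (core i) x.
  case: (caterpillarP x) => [i|e|i k]; first by exists i.
    have [i [j [_ eE]]] := edgeP e; exists i; apply: connect1 => /=.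
    by rewrite eE set21.
  by exists i; apply: connect1 => /=; rewrite eqxx.
move=> x y; have [i ix] := core_any x; have [j jy] := core_any y.
by rewrite csym in ix; apply: connect_trans ix (connect_trans (core_core i j) jy).
Qed.

End Caterpillar.

Arguments leaf {K p} i k.

(** * The two trees on four vertices and the family they generate *)

Record skeleton (K : sgraph) : Prop := Skeleton {
  skeleton_card : #|K| = 4%N;
  skeleton_connected : gconnected K;
  skeleton_gdeg : (\sum_(i : K) gdeg i = 6)%N;
  (* [par r] sends a vertex to its neighbour in the direction of the root [r]. *)
  skeleton_parent : exists par : K -> K -> K,
    (forall r i, i != r -> sedge i (par r i)) /\
    (forall r i j, i != r -> j != r -> par r i = j -> par r j = i -> False) }.

Lemma ord4P (P : 'I_4 -> Prop) :
  P (inord 0) -> P (inord 1) -> P (inord 2) -> P (inord 3) -> forall i, P i.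
Proof.
move=> P0 P1 P2 P3 [[|[|[|[|i]]]] lt_i4] //.
- by rewrite (_ : Ordinal _ = inord 0) //; apply: val_inj; rewrite /= inordK.
- by rewrite (_ : Ordinal _ = inord 1) //; apply: val_inj; rewrite /= inordK.
- by rewrite (_ : Ordinal _ = inord 2) //; apply: val_inj; rewrite /= inordK.
- by rewrite (_ : Ordinal _ = inord 3) //; apply: val_inj; rewrite /= inordK.
Qed.

Lemma gconnected_parent (K : sgraph) (r : K) (f : K -> K) (h : K -> nat) :
  (forall i, i != r -> sedge i (f i) /\ (h (f i) < h i)%N) -> gconnected K.
Proof.
move=> fP; split; first by apply/card_gt0P; exists r.
have csym : connect_sym (@sedge K) by apply: sym_connect_sym; exact: sedge_sym.
have to_r m i : (h i < m)%N -> connect sedge i r.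
  elim: m i => // m IH i le_him; have [->|/fP[i_fi lt_h]] := eqVneq i r; first exact: connect0.
  by apply: connect_trans (connect1 i_fi) (IH _ _); rewrite (leq_trans lt_h).
move=> i j; apply: connect_trans (to_r _ i (ltnSn _)) _.
by rewrite csym; exact: to_r _ j (ltnSn _).
Qed.

Lemma gdeg_sum (K : sgraph) (i : K) : gdeg i = (\sum_(j : K) sedge i j)%N.
Proof.
by rewrite /gdeg -sum1_card big_mkcond; apply: eq_bigr => j _; rewrite inE; case: sedge.
Qed.

Fact neq_val (i j : 'I_4) : i != j -> (i != j :> nat)%N.
Proof. by rewrite -val_eqE. Qed.

Lemma K13_skeleton : skeleton K13.
Proof.
split; first exact: card_ord.
- apply: (@gconnected_parent K13 (inord 3) (fun=> inord 3) (fun i : 'I_4 => (i != 3 :> nat)%N)).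
  move=> i; rewrite -val_eqE /= inordK // /star_edge => i3.
  by rewrite inordK // eqxx (negPf i3).
- under eq_bigr do rewrite gdeg_sum; rewrite !big_ord_recl !big_ord0 /=.
  by rewrite /= /star_edge.
exists (fun r i : 'I_4 => if i == 3 :> nat then r else inord 3); split=> [r i|r i j].
  rewrite /= /star_edge => ir; case: (eqVneq (i : nat) 3%N) => [i3|_]; last by rewrite inordK.
  by apply: contraNneq ir => r3; apply/eqP/val_inj; rewrite /= i3 r3.
move=> /= ir jr; case: (eqVneq (i : nat) 3%N) => [_ rj|_ <-]; first by rewrite rj eqxx in jr.
by rewrite inordK //= => ri; rewrite ri eqxx in ir.
Qed.

Lemma P4_skeleton : skeleton P4.
Proof.
split; first exact: card_ord.
- apply: (@gconnected_parent P4 (inord 3) (fun i : 'I_4 => inord i.+1) (fun i : 'I_4 => 3 - i)%N).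
  move=> i; rewrite -val_eqE /= inordK // /path_edge => i3.
  have lt_i3 : (i < 3)%N by have := ltn_ord i; move: i3; lia.
  by rewrite inordK // eqxx; split=> //; lia.
- under eq_bigr do rewrite gdeg_sum; rewrite !big_ord_recl !big_ord0 /=.
  by rewrite /= /path_edge.
exists (fun r i : 'I_4 => inord (if (i < r)%N then i.+1 else i.-1)); split=> [r i|r i j].
  move=> /neq_val ir; have lt_r := ltn_ord r; have lt_i := ltn_ord i.
  by rewrite /= /path_edge inordK; case: ifP => lt_ir; lia.
move=> /neq_val ir /neq_val jr /(congr1 val) /= + /(congr1 val) /=.
have lt_r := ltn_ord r; have lt_i := ltn_ord i; have lt_j := ltn_ord j.
by rewrite !inordK; do ?[case: ifP => ?]; lia.
Qed.

Section CaterpillarFamily.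
Variables (K : sgraph) (p : K -> nat).
Hypothesis K_skel : skeleton K.
Notation H := (caterpillar p).
Notation edge := {e : {set K} | @is_edge K e}.

Lemma card_skeleton_caterpillar : #|H| = (7 + \sum_i p i)%N.
Proof.
rewrite card_caterpillar (skeleton_card K_skel).
by have := card_edges K; rewrite (skeleton_gdeg K_skel); lia.
Qed.

(** The upper bound comes from a matching that saturates the four core vertices: a core vertex [r]
    bearing a pendant edge is matched with its leaf, any other one with the middle of its edge
    towards [r]. An independent set misses an end of each matching edge. The complement of the core
    attains the bound. *)
Lemma independence_caterpillar : (0 < \sum_i p i)%N ->
  independence_number H = (3 + \sum_i p i)%N.
Proof.
rewrite lt0n sum_nat_eq0 negb_forall => /existsP[r /=]; rewrite -lt0n => pr_gt0.
have [par [par_edge par_inj]] := skeleton_parent K_skel.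
have cardH := card_skeleton_caterpillar; have cardK := skeleton_card K_skel.
apply/eqP; rewrite eqn_leq; apply/andP; split.
  apply/bigmax_leqP => S /forall_inP S_ind.
  (* The final default is never taken, since [par r i] is adjacent to [i] for [i != r]. *)
  pose m i : H := if i == r then leaf r (Ordinal pr_gt0) else
    if insub [set i; par r i] is Some e then mid p e else core p i.
  have mE i : i != r -> exists2 e : edge, m i = mid p e & val e = [set i; par r i] :> {set K}.
    move=> ir; rewrite /m (negPf ir).
    by case: insubP => [e _ <-|]; [exists e|rewrite edge_exists ?par_edge].
  have m_adj i : sedge (core p i) (m i).
    have [->|ir] := eqVneq i r; first by rewrite /m eqxx /= eqxx.
    by have [e -> eE] := mE i ir; rewrite /= eE set21.
  have m_core i j : m i <> core p j.
    by move=> mc; have := m_adj i; rewrite mc.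
  have m_inj : injective m.
    have leaf_mid i j : i = r -> j != r -> m i <> m j.
      by move=> -> /mE[e -> _]; rewrite /m eqxx.
    move=> i j; have [ir|ir] := eqVneq i r; have [jr|jr] := eqVneq j r.
    - by rewrite ir jr.
    - by move/(leaf_mid _ _ ir jr).
    - by move/esym/(leaf_mid _ _ jr ir).
    have [e -> eE] := mE i ir; have [f -> fE] := mE j jr => -[ef].
    have eqS : [set i; par r i] = [set j; par r j] by rewrite -eE -fE ef.
    have : i \in [set j; par r j] by rewrite -eqS set21.
    rewrite !inE => /orP[/eqP //|/eqP i_pj].
    have : j \in [set i; par r i] by rewrite eqS set21.
    by rewrite !inE => /orP[/eqP //|/eqP j_pi]; case: (par_inj r i j).
  pose f i := if core p i \in S then m i else core p i.
  have f_inj : injective f.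
    move=> i j; rewrite /f; case: ifP => iS; case: ifP => jS; first exact: m_inj.
    - by move/m_core.
    - by move/esym/m_core.
    by case.
  have fS i : f i \in ~: S.
    rewrite inE /f; case: ifP => [iS|-> //]; apply: contraTN (m_adj i) => mS.
    by have /forall_inP/(_ _ mS) := S_ind _ iS.
  have := max_card (mem S); have := cardsC S.
  have : (4 <= #|~: S|)%N.
    have <- : #|[set f i | i in K]| = 4%N by rewrite card_imset ?cardK.
    apply: subset_leq_card.
    by apply/subsetP => _ /imsetP[i _ ->].
  rewrite cardH; lia.
pose S : {set H} := ~: [set core p i | i : K].
have -> : (3 + \sum_i p i = #|S|)%N.
  have := cardsC [set core p i | i : K]; rewrite card_imset ?cardH -/S; last by move=> i j [].
  have -> : #|[pred _ : K | true]| = 4%N by rewrite -cardK.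
  lia.
apply: (@leq_bigmax_cond _ _ _ S); apply/forall_inP => x xS; apply/forall_inP => y yS.
have notcore i : core p i \notin S by rewrite inE negbK imset_f.
case: (caterpillarP x) xS => [i|e|i k]; first by rewrite (negPf (notcore i)).
all: move=> _; case: (caterpillarP y) yS => [j|f|j h] //; by rewrite (negPf (notcore j)).
Qed.

Lemma caterpillar_in_family n : (8 <= n)%N -> (\sum_i p i = n - 7)%N ->
  in_family n (n - 4) H.
Proof.
move=> n8 sum_p; split.
- by rewrite card_skeleton_caterpillar sum_p; lia.
- exact/caterpillar_connected/skeleton_connected.
- by rewrite independence_caterpillar sum_p; lia.
Qed.

End CaterpillarFamily.

(** * Test vectors determined by their values on the core *)

Section CaterpillarTest.
Variables (R : realType) (s l : R) (K : sgraph) (p : K -> nat) (X : K -> R).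
Hypothesis l_gt2s : 2 * s < l.
Hypothesis s_ge0 : 0 <= s.
Notation H := (caterpillar p).

(* Value at a core vertex of [A_op] applied to the extension of [X] to the
   subdividing and pendant vertices that satisfies the eigenvalue equation for
   [l] there. *)
Definition core_op (i : K) : R :=
  \sum_(j | sedge i j) (s * X i + (1 - s) ^+ 2 / (l - 2 * s) * (X i + X j)) +
  (p i)%:R * (s + (1 - s) ^+ 2 / (l - s)) * X i.

Definition core_extension (x : H) : R :=
  match x with
  | inl (inl i) => X i
  | inl (inr e) => (1 - s) / (l - 2 * s) * \sum_(i in val e) X i
  | inr q => if tag q is inl i then (1 - s) / (l - s) * X i else 0
  end.

Lemma A_op_core i : A_op s core_extension (core p i) = core_op i.
Proof.
rewrite /A_op big_caterpillar /= big_pred0 // add0r; congr (_ + _); last first.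
  rewrite (bigD1 i) //= [X in _ + X]big1 ?addr0; last first.
    by move=> j ne_ji; apply: big_pred0 => k; apply/eqP => -[]/eqP; rewrite (negPf ne_ji).
  rewrite (eq_bigl predT) => [|k]; last by rewrite eqxx.
  by rewrite sumr_const card_ord -mulr_natl; ring.
rewrite (big_edges i (fun e : {set K} =>
  s * X i + (1 - s) * ((1 - s) / (l - 2 * s) * \sum_(j in e) X j))).
apply: eq_bigr => j ij; rewrite big_setU1 ?big_set1 /=; first by congr (_ + _); ring.
by rewrite inE; apply: contraTneq ij => ->; rewrite sedge_irr.
Qed.

Lemma A_op_noncore x : (forall i, x <> core p i) ->
  A_op s core_extension x = l * core_extension x.
Proof.
have l2s : l - 2 * s != 0 by rewrite subr_eq0 gt_eqF.
have ls : l - s != 0 by move: l_gt2s s_ge0 => h1 h2; apply/eqP; lra.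
case: (caterpillarP x) => [i /(_ i)//|e|i k] _; rewrite /A_op big_caterpillar /=.
  rewrite [X in _ + X + _]big_pred0 // [X in _ + X]big1; last by move=> j _; exact: big_pred0.
  rewrite !addr0 big_split /= sumr_const card_edge -mulr_sumr -mulr_natr.
  by set S := \sum_(_ in _) _; field.
rewrite [X in _ + X + _]big_pred0 // [X in _ + X]big1; last by move=> j _; exact: big_pred0.
rewrite !addr0 (eq_bigl (pred1 i)) => [|j]; last first.
  by rewrite /= eq_sym.
by rewrite big_pred1_eq; field.
Qed.

End CaterpillarTest.

(** * Recognition of subdivided trees with pendant edges *)

Definition nbs (G : sgraph) (w : G) : {set G} := [set z | sedge w z].

Lemma in_nbs (G : sgraph) (w z : G) : (z \in nbs w) = sedge w z.
Proof. by rewrite inE. Qed.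

(* [G] is [K] subdivided, with pendant edges, [phi] being the embedding of the
   vertices of [K]. *)
Definition realizes (G K : sgraph) (phi : K -> G) : Prop :=
  [/\ injective phi, forall i j, ~~ sedge (phi i) (phi j),
    forall w, w \notin codom phi ->
      (exists i, nbs w = [set phi i]) \/
      (exists i j, sedge i j /\ nbs w = [set phi i; phi j])
    & forall i j, sedge i j -> exists w, nbs w = [set phi i; phi j] /\
        forall w', nbs w' = [set phi i; phi j] -> w' = w].

Definition pendant_nb (G K : sgraph) (phi : K -> G) (i : K) : nat :=
  #|[set w | nbs w == [set phi i]]|.

Lemma giso_sym G H : giso G H -> giso H G.
Proof.
case=> f [g fK gK] fE; exists g => [|x y]; first by exists f.
by rewrite -fE !gK.
Qed.

Section Recognition.
Variables (G K : sgraph) (phi : K -> G).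
Hypothesis phi_real : realizes phi.
Notation edge := {e : {set K} | @is_edge K e}.
Let p : K -> nat := pendant_nb phi.

Let mid_exists (e : edge) : exists w, nbs w == [set phi i | i in (val e : {set K})].
Proof.
have [_ _ _ mids] := phi_real; have [i [j [ij ->]]] := edgeP e.
by have [w [wE _]] := mids i j ij; exists w; rewrite wE imsetU1 imset_set1.
Qed.

(** Leaves at [i] enumerate the vertices whose neighbourhood is [[set phi i]]. The last branch has
    an empty index type, because [pendant_count] is 0 on subdividing vertices; its value is
    arbitrary. *)
Let f (x : caterpillar p) : G :=
  match x with
  | inl (inl i) => phi i
  | inl (inr e) => xchoose (mid_exists e)
  | inr (existT x k) =>
    match x return 'I_(pendant_count p x) -> G with
    | inl i => fun k => enum_val (k : 'I_#|[set w | nbs w == [set phi i]]|)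
    | inr e => fun=> xchoose (mid_exists e)
    end k
  end.

Let nbs_mid e : nbs (f (mid p e)) = [set phi i | i in (val e : {set K})].
Proof. exact/eqP/(xchooseP (mid_exists e)). Qed.

Let nbs_leaf i k : nbs (f (@leaf K p i k)) = [set phi i].
Proof.
by have := enum_valP (k : 'I_#|[set w | nbs w == [set phi i]]|); rewrite inE => /eqP.
Qed.

(** Every vertex outside the image of [phi] has its whole neighbourhood inside it, and [f] carries
    neighbourhoods to neighbourhoods. Hence adjacency has content only between a core and a noncore
    vertex. *)
Lemma realizes_giso : giso G (caterpillar p).
Proof.
have [phi_inj phi_indep others mids] := phi_real.
have noncore w i : i \in [set j | sedge w (phi j)] -> w \notin codom phi.
  by rewrite inE => wi; apply/codomP => -[j wj]; have := phi_indep j i; rewrite -wj wi.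
have mid_noncore e : f (mid p e) \notin codom phi.
  have [i [j [_ eE]]] := edgeP e; apply: (noncore _ i).
  by rewrite inE -in_nbs nbs_mid imset_f // eE set21.
have leaf_noncore i k : f (@leaf K p i k) \notin codom phi.
  by apply: (noncore _ i); rewrite inE -in_nbs nbs_leaf set11.
have core_noncore i w : w \notin codom phi -> phi i <> w.
  by move=> wN iw; rewrite -iw codom_f in wN.
have card_mid (e : edge) : #|[set phi i | i in (val e : {set K})]| = 2%N.
  by rewrite card_imset // card_edge.
have mid_leaf e i k : f (mid p e) <> f (@leaf K p i k).
  move/(congr1 (fun w => #|nbs w|)); rewrite nbs_mid nbs_leaf card_mid.
  by rewrite cards1.
apply: giso_sym; exists f.
  have f_inj : injective f.
    move=> x y; case: (caterpillarP x) => [i|e|i k]; case: (caterpillarP y) => [j|e'|j k'].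
    - by move/phi_inj->.
    - by move/(core_noncore _ _ (mid_noncore _)).
    - by move/(core_noncore _ _ (leaf_noncore _ _)).
    - by move/esym/(core_noncore _ _ (mid_noncore _)).
    - move/(congr1 (@nbs G)); rewrite !nbs_mid => /(imset_inj phi_inj)/val_inj.
      by move->.
    - by move/mid_leaf.
    - by move/esym/(core_noncore _ _ (leaf_noncore _ _)).
    - by move/esym/mid_leaf.
    have [ij|ne_ij] := eqVneq i j; last first.
      move/(congr1 (@nbs G)); rewrite !nbs_leaf => /set1_inj/phi_inj ij.
      by rewrite ij eqxx in ne_ij.
    by move: k'; rewrite -ij => k' /= /enum_val_inj->.
  apply: (inj_card_bij f_inj); rewrite -(card_codom f_inj); apply: subset_leq_card.
  apply/subsetP => w _; have [/codomP[i ->]|wN] := boolP (w \in codom phi).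
    by apply/codomP; exists (core p i).
  case: (others w wN) => [[i wE]|[i [j [ij wE]]]].
    have wS : w \in [set w | nbs w == [set phi i]] by rewrite inE wE.
    apply/codomP; exists (@leaf K p i (enum_rank_in wS w)).
    by rewrite /= enum_rankK_in.
  pose e : edge := exist _ [set i; j] (edge_exists ij).
  apply/codomP; exists (mid p e).
  have [w0 [_ uniq]] := mids i j ij; rewrite (uniq w wE); apply/esym/uniq.
  by rewrite nbs_mid imsetU1 imset_set1.
have core_f i y : (forall j, y <> core p j) -> sedge (f (core p i)) (f y) = sedge (core p i) y.
  case: (caterpillarP y) => [j /(_ j)//|e|j k] _; rewrite sedge_sym -in_nbs.
    by rewrite nbs_mid; exact: mem_imset.
  by rewrite nbs_leaf inE -/(phi i) (inj_eq phi_inj) /= eq_sym.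
have nbs_core x w : (forall i, x <> core p i) -> w \notin codom phi -> ~~ sedge (f x) w.
  case: (caterpillarP x) => [j /(_ j)//|e|j k] _; apply: contra; rewrite -in_nbs.
    by rewrite nbs_mid => /imsetP[i _ ->]; exact: codom_f.
  by rewrite nbs_leaf inE => /eqP->; exact: codom_f.
move=> x y; case: (caterpillarP x) => [i|e|i k]; case: (caterpillarP y) => [j|e'|j k'].
- exact/negbTE/phi_indep.
- by rewrite core_f.
- by rewrite core_f.
- by rewrite sedge_sym core_f // sedge_sym.
- exact/negbTE/nbs_core.
- exact/negbTE/nbs_core.
- by rewrite sedge_sym core_f // sedge_sym.
- exact/negbTE/nbs_core.
- exact/negbTE/nbs_core.
Qed.

Lemma realizes_gdeg i : (p i + gdeg i <= gdeg (phi i))%N.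
Proof.
have [phi_inj phi_indep others mids] := phi_real.
pose P := [set w | nbs w == [set phi i]].
pose Q := [set w | nbs w \in [set [set phi i; phi j] | j in nbs i]].
have card_pair j : sedge i j -> #|[set phi i; phi j]| = 2%N.
  move=> ij; rewrite cards2 (inj_eq phi_inj).
  by case: eqP ij => // <-; rewrite sedge_irr.
have PQ : [disjoint P & Q].
  rewrite -setI_eq0; apply/eqP/setP => w; rewrite !inE; apply/negP => /andP[/eqP->].
  case/imsetP=> j; rewrite in_nbs => /card_pair ij /(congr1 (fun S : {set G} => #|S|)).
  by rewrite ij cards1.
have Q_ge : (gdeg i <= #|Q|)%N.
  apply: (@leq_trans #|[set [set phi i; phi j] | j in nbs i]|).
    rewrite card_in_imset // => j k; rewrite !in_nbs => ij ik eq_jk.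
    have : phi j \in [set phi i; phi k] by rewrite -eq_jk set22.
    rewrite !inE !(inj_eq phi_inj) => /orP[/eqP ji|/eqP //].
    by rewrite ji sedge_irr in ij.
  apply: leq_trans (leq_imset_card (@nbs G) (mem Q)); apply: subset_leq_card.
  apply/subsetP => _ /imsetP[j ij ->]; have := ij; rewrite in_nbs => /mids[w [wE _]].
  by apply/imsetP; exists w; rewrite ?wE // inE wE; apply/imsetP; exists j.
have : (#|P :|: Q| <= gdeg (phi i))%N.
  apply/subset_leq_card/subsetP => w; rewrite !inE => wPQ.
  rewrite sedge_sym -in_nbs; case/orP: wPQ => [/eqP->|/imsetP[j _ ->]].
    by rewrite set11.
  by rewrite set21.
rewrite cardsU; move: PQ; rewrite -setI_eq0 => /eqP->; rewrite cards0 subn0.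
by apply: leq_trans; rewrite leq_add2l.
Qed.

Lemma realizes_sum_pendant : skeleton K -> (\sum_i p i = #|G| - 7)%N.
Proof.
move=> K_skel; have [g g_bij _] := realizes_giso.
by rewrite (bij_eq_card g_bij) card_skeleton_caterpillar // addKn.
Qed.

End Recognition.

Lemma realizes_relabel (G K : sgraph) (phi : K -> G) (tau : K -> K) :
  injective tau -> (forall i j, sedge (tau i) (tau j) = sedge i j) ->
  realizes phi -> realizes (phi \o tau).
Proof.
move=> tau_inj tauE [phi_inj phi_indep others mids].
have tauK : forall i, tau (invF tau_inj i) = i by exact: f_invF.
split=> [|i j|w wN|i j ij]; first exact: inj_comp.
- exact: phi_indep.
- have {}wN : w \notin codom phi.
    by apply: contra wN => /codomP[i ->]; rewrite -(tauK i); exact: (codom_f (phi \o tau)).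
  case: (others w wN) => [[i wE]|[i [j [ij wE]]]]; [left|right].
    by exists (invF tau_inj i); rewrite wE /= tauK.
  exists (invF tau_inj i), (invF tau_inj j); rewrite wE /= !tauK; split=> //.
  by rewrite -tauE !tauK.
by apply: mids; rewrite tauE.
Qed.

(** Used to distribute [N] pendant edges when [cap] bounds the number at each vertex. *)
Lemma exists_le_sum (I : finType) (cap : I -> nat) (N : nat) :
  (N <= \sum_i cap i)%N ->
  exists2 p : I -> nat, (forall i, p i <= cap i)%N & (\sum_i p i = N)%N.
Proof.
elim: N => [|N IH] leN; first by exists (fun=> 0%N) => //; rewrite big1.
have [p p_le p_sum] := IH (ltnW leN).
have [/existsP[i lt_i]|] := boolP [exists i, (p i < cap i)%N]; last first.
  rewrite negb_exists => /forallP cap_le; move: leN; rewrite -p_sum ltnNge leq_sum //.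
  by move=> i _; rewrite leqNgt cap_le.
exists (fun j => p j + (j == i))%N => [j|].
  by case: eqVneq => [->|_]; rewrite ?addn1 ?addn0.
by rewrite big_split /= p_sum -big_mkcond /= big_pred1_eq addn1.
Qed.

(** * Scalar inequalities between the weights of neighbours *)

Section RealInequalities.
Variable R : realType.
Implicit Types s l d k X Y : R.

(** [p] and [q] are the weights of a pendant and of a subdividing vertex: what the eigenvalue
    equation at a vertex of degree 1 or 2 sends back to each neighbour, per unit of its neighbours'
    entries. *)
Let p s l := (1 - s) ^+ 2 / (l - s).
Let q s l := (1 - s) ^+ 2 / (l - 2 * s).

(** Here [d] is the degree in the path and [k] the number of pendant edges at a vertex where a
    constant vector is tested. The left side is [(d + k) * (s + p s l) + d * (2 * q s l - p s l)];
    as [d <= 2], it stays below [(M + 1) * (s + p s l)] once 4q - 3p < s. *)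
Lemma path_test_lt s l d k M :
  2^-1 <= s -> s < 1 -> 3 <= M -> (M + 1) * (s + p s l) <= l -> s < l ->
  0 <= d <= 2 -> d + k <= M -> d * (s + q s l * 2) + k * (s + p s l) < l.
Proof.
move=> s_ge s_lt M_ge l_ge ls /andP[d_ge d_le] dk_le.
have s_gt : 0 < s by apply: lt_le_trans s_ge; rewrite invr_gt0.
have c_le : 1 - s <= s by move: s_ge; rewrite -[2^-1]div1r ler_pdivrMr //; lra.
have c_gt : 0 < 1 - s by rewrite subr_gt0.
have p_gt : 0 < p s l by rewrite divr_gt0 ?exprn_gt0 // subr_gt0.
have l4 : 4 * s < l by apply: lt_le_trans l_ge; nra.
(* After bounding [(1 - s) ^+ 2] by [s ^+ 2] this amounts to [4 * s < l], which [3 <= M]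
   provides. *)
have key : 4 * q s l - 3 * p s l < s.
  have h1 : 0 < l - s by lra.
  have h2 : 0 < l - 2 * s by lra.
  have -> : 4 * q s l - 3 * p s l =
      (1 - s) ^+ 2 * (l + 2 * s) / ((l - 2 * s) * (l - s)).
    by rewrite /p /q; field; rewrite !gt_eqF.
  rewrite ltr_pdivrMr ?mulr_gt0 //.
  have c2 : (1 - s) ^+ 2 <= s ^+ 2 by rewrite lerXn2r ?nnegrE // ltW.
  apply: (@le_lt_trans _ _ (s ^+ 2 * (l + 2 * s))).
    by rewrite ler_wpM2r //; lra.
  have : 0 < s * (l * (l - 4 * s)) by rewrite !mulr_gt0 //; lra.
  by nra.
have q_gt : 0 < q s l by rewrite divr_gt0 ?exprn_gt0 //; lra.
move: (q s l) (p s l) key p_gt q_gt l_ge => Q P key P_gt Q_gt l_ge.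
have : (d + k) * (s + P) <= M * (s + P) by rewrite ler_wpM2r //; lra.
by case: (lerP (2 * Q - P) 0) => h; nra.
Qed.

(** Linear interpolation of the weight between k = 1 and k = 2, with exact remainder; the remainder
    vanishes at these two points and is positive from k = 3 on. *)
Lemma weight_convex s l k : s < l -> 2 * s < l -> k * s < l ->
  (1 - s) ^+ 2 / (l - k * s) = p s l + (k - 1) * (q s l - p s l) +
    (1 - s) ^+ 2 * s ^+ 2 * ((k - 1) * (k - 2)) / ((l - s) * (l - 2 * s) * (l - k * s)).
Proof.
move=> h1 h2 h3; rewrite /p /q; field.
by rewrite !subr_eq0 !gt_eqF.
Qed.

Lemma direct_nonedge_gt0 s l X Y (d : R) : s < 1 -> 0 < s -> s < l -> 0 < Y -> 1 <= d ->
  (1 - s) * X < (l - s * d) * Y -> 0 < (1 - s) * Y - p s l * X.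
Proof.
move=> s_lt s_gt ls Y_gt d_ge XY.
have -> : (1 - s) * Y - p s l * X = (1 - s) / (l - s) * ((l - s) * Y - (1 - s) * X).
  by rewrite /p; field; rewrite subr_eq0 gt_eqF.
rewrite mulr_gt0 ?divr_gt0 ?subr_gt0 //; apply: lt_le_trans XY _.
by apply: ler_wpM2r; [exact: ltW|nra].
Qed.

(** From [1 - s <= s] one gets l - 2s - (1 - s) >= l - 3s >= l - s d; this is why a neighbour inside
    the cover pays for a tree edge when its degree is at least 3. *)
Lemma direct_edge_gt0 s l X Y (d : R) : 2^-1 <= s -> s < 1 -> 2 * s < l -> 0 < Y -> 3 <= d ->
  (1 - s) * X < (l - s * d) * Y -> 0 < (1 - s) * Y - q s l * (X + Y).
Proof.
move=> s_ge s_lt l2s Y_gt d_ge XY.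
have s_gt : 0 < s by apply: lt_le_trans s_ge; rewrite invr_gt0.
have c_le : 1 - s <= s by move: s_ge; rewrite -[2^-1]div1r ler_pdivrMr //; lra.
have -> : (1 - s) * Y - q s l * (X + Y) =
    (1 - s) / (l - 2 * s) * ((l - 2 * s - (1 - s)) * Y - (1 - s) * X).
  by rewrite /q; field; rewrite subr_eq0 gt_eqF.
rewrite mulr_gt0 ?divr_gt0 ?subr_gt0 //; apply: lt_le_trans XY _.
by apply: ler_wpM2r; [exact: ltW|nra].
Qed.

(** The term [(s + p s l) * X] is the value of one pendant edge, given up in exchange for the tree
    edge. Then [q s l < 1 - s <= s] makes both coefficients positive. *)
Lemma low_edge_gt0 s l X Y : 2^-1 <= s -> s < 1 -> 3 * s < l -> 0 < Y -> 0 < X ->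
  0 < (1 - s) * Y - (q s l * (X + Y) - (s + p s l) * X).
Proof.
move=> s_ge s_lt l3s Y_gt X_gt.
have s_gt : 0 < s by apply: lt_le_trans s_ge; rewrite invr_gt0.
have c_le : 1 - s <= s by move: s_ge; rewrite -[2^-1]div1r ler_pdivrMr //; lra.
have c_gt : 0 < 1 - s by rewrite subr_gt0.
have p_gt : 0 < p s l by rewrite divr_gt0 ?exprn_gt0 //; lra.
have q_lt : q s l < 1 - s.
  rewrite ltr_pdivrMr; last by lra.
  by rewrite expr2 ltr_pM2l //; lra.
have : 0 < (1 - s - q s l) * Y by rewrite mulr_gt0 // subr_gt0.
have : 0 < (s + p s l - q s l) * X by rewrite mulr_gt0 //; lra.
by move: (p s l) (q s l) => P Q; nra.
Qed.

(* [k] is the degree of a vertex outside the cover with eigenvector entry [z],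
   [X] the entry of one neighbour and [Y] the sum over [m] other neighbours. *)
Lemma indirect_ge0 s l X Y z (k m : nat) :
  0 < s -> s < 1 -> s < l -> 2 * s < l -> k%:R * s < l -> (m < k)%N -> 0 < X -> 0 <= Y ->
  (m = 0%N -> Y = 0) -> (1 - s) * (X + Y) <= (l - s * k%:R) * z ->
  let T := (1 - s) * z - p s l * X - (m%:R * (q s l - p s l) * X + q s l * Y) in
  0 <= T /\ (T = 0 -> k = 1%N \/ k = 2%N /\ m = 1%N).
Proof.
move=> s_gt s_lt ls l2s lks lt_mk X_gt Y_ge Y0 XYz T.
have lks' : 0 < l - k%:R * s by rewrite subr_gt0.
have c_gt : 0 < 1 - s by rewrite subr_gt0.
have rk := weight_convex ls l2s lks.
have [r rE] : exists r, r = (1 - s) ^+ 2 / (l - k%:R * s) by eexists.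
rewrite -rE in rk.
have zr : r * (X + Y) <= (1 - s) * z.
  have -> : r * (X + Y) = (1 - s) / (l - k%:R * s) * ((1 - s) * (X + Y)).
    by rewrite rE; field; rewrite gt_eqF.
  have -> : (1 - s) * z = (1 - s) / (l - k%:R * s) * ((l - s * k%:R) * z).
    by field; rewrite gt_eqF.
  by rewrite ler_wpM2l // divr_ge0 // ltW.
have pq : p s l < q s l.
  rewrite /p /q ltr_pM2l ?exprn_gt0 // ltf_pV2 ?posrE ?subr_gt0 //; lra.
have T_ge : (r - p s l - m%:R * (q s l - p s l)) * X + (r - q s l) * Y <= T.
  by rewrite /T; move: zr; set A := (1 - s) * z; nra.
clearbody T; clear rE zr XYz.
(* The lower bound is 0 for k = 1, and for k = 2 with m = 1. For k = 2 and m = 0 it is (q - p) X;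
   for k >= 3 the convexity remainder makes it positive. *)
case: k lt_mk lks lks' rk => [|[|[|k]]] // lt_mk lks lks' rk.
- have m0 : m = 0%N by move: lt_mk; rewrite ltnS leqn0 => /eqP.
  split; last by left.
  by apply: le_trans T_ge; rewrite (Y0 m0) m0 rk [leRHS](_ : _ = 0) //; ring.
- case: m lt_mk Y0 T_ge => [|[|m]] // _ Y0 T_ge.
    have T_gt : 0 < T.
      apply: lt_le_trans T_ge; rewrite (Y0 erefl) rk.
      have : 0 < (q s l - p s l) * X by rewrite mulr_gt0 // subr_gt0.
      by move: (p s l) (q s l) => P Q; lra.
    by split; [exact: ltW|move=> T0; rewrite T0 ltxx in T_gt].
  split; last by right.
  by apply: le_trans T_ge; rewrite rk [leRHS](_ : _ = 0) //; ring.
set e := _ / _ in rk.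
have e_gt : 0 < e.
  have k_ge : (0 : R) <= k%:R by [].
  rewrite /e divr_gt0 ?mulr_gt0 ?exprn_gt0 ?subr_gt0 // -!natr1; lra.
have m_le : (m%:R : R) <= k.+3%:R - 1.
  by rewrite -[k.+3%:R]natr1 addrK ler_nat -ltnS.
have T_gt : 0 < T.
  apply: lt_le_trans T_ge; rewrite rk.
  have k_ge : (1 : R) <= k.+3%:R - 1 by rewrite -[k.+3%:R]natr1 addrK ler1n.
  have D_gt : 0 < q s l - p s l by rewrite subr_gt0.
  have h1 : 0 < (p s l + (k.+3%:R - 1) * (q s l - p s l) + e - p s l -
      m%:R * (q s l - p s l)) * X.
    rewrite mulr_gt0 //; move: (p s l) (q s l) D_gt => P Q D_gt.
    have : 0 <= (k.+3%:R - 1 - m%:R) * (Q - P) by rewrite mulr_ge0 ?subr_ge0 // ltW // -subr_gt0.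
    by nra.
  have h2 : 0 <= (p s l + (k.+3%:R - 1) * (q s l - p s l) + e - q s l) * Y.
    rewrite mulr_ge0 //; move: (p s l) (q s l) D_gt => P Q D_gt.
    have : 0 <= (k.+3%:R - 1 - 1) * (Q - P) by rewrite mulr_ge0 ?subr_ge0 // ltW // -subr_gt0.
    by nra.
  exact: ltr_wpDr.
by split; [exact: ltW|move=> T0; rewrite T0 ltxx in T_gt].
Qed.

End RealInequalities.
(** * Spanning trees of a vertex cover *)

(* An enumeration of the edges from child to parent; [rk] orients them acyclically. *)
Definition edge_enum (K : sgraph) (ch pa : 'I_3 -> K) (rk : K -> nat) : Prop :=
  [/\ injective ch, forall k, sedge (ch k) (pa k), forall k, (rk (ch k) < rk (pa k))%N &
    forall F : K -> K -> nat, (forall i j, F i j = F j i) ->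
      (\sum_i \sum_(j | sedge i j) F i j = 2 * \sum_k F (ch k) (pa k))%N].

Lemma sum_ord4 (F : 'I_4 -> nat) :
  (\sum_i F i = F (inord 0) + F (inord 1) + F (inord 2) + F (inord 3))%N.
Proof.
rewrite !big_ord_recl big_ord0 addn0 !addnA.
by do 3?[congr (_ + _)%N]; congr F; apply: val_inj; rewrite /= inordK.
Qed.

Lemma sum_ord3 (F : 'I_3 -> nat) : (\sum_i F i = F (inord 0) + F (inord 1) + F (inord 2))%N.
Proof.
rewrite !big_ord_recl big_ord0 addn0 !addnA.
by do 2?[congr (_ + _)%N]; congr F; apply: val_inj; rewrite /= inordK.
Qed.

Lemma K13_edge_enum :
  @edge_enum K13 (fun k => inord k) (fun=> inord 3) (fun i : 'I_4 => i).
Proof.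
split=> [k k' /(congr1 val)|k|k|F F_sym] /=.
- rewrite !inordK; [exact: val_inj|..]; exact: leq_trans (ltn_ord _) _.
- by rewrite /star_edge !inordK ?(ltn_trans (ltn_ord k)) // (ltn_eqF (ltn_ord k)).
- by have k3 := ltn_ord k; rewrite !inordK //; lia.
under eq_bigr do rewrite big_mkcond /= sum_ord4.
rewrite sum_ord4 sum_ord3 /star_edge /= !inordK //=.
rewrite (F_sym (inord 3) (inord 0)) (F_sym (inord 3) (inord 1)) (F_sym (inord 3) (inord 2)).
lia.
Qed.

Lemma P4_edge_enum :
  @edge_enum P4 (fun k => inord k) (fun k => inord k.+1) (fun i : 'I_4 => i).
Proof.
split=> [k k' /(congr1 val)|k|k|F F_sym] /=.
- rewrite !inordK; [exact: val_inj|..]; exact: leq_trans (ltn_ord _) _.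
- have k3 := ltn_ord k; rewrite /path_edge !inordK ?eqxx //; lia.
- have k3 := ltn_ord k; rewrite !inordK //; lia.
under eq_bigr do rewrite big_mkcond /= sum_ord4.
rewrite sum_ord4 sum_ord3 /path_edge /= !inordK //=.
rewrite (F_sym (inord 1) (inord 0)) (F_sym (inord 2) (inord 1)) (F_sym (inord 3) (inord 2)).
lia.
Qed.

Lemma K13_gdeg (i : K13) : gdeg i = if i == 3 :> nat then 3%N else 1%N.
Proof.
rewrite gdeg_sum !big_ord_recl big_ord0 /=.
by case: i => [[|[|[|[|]]]]].
Qed.

Lemma P4_gdeg (i : P4) : gdeg i = if (i == 0 :> nat) || (i == 3 :> nat) then 1%N else 2%N.
Proof.
rewrite gdeg_sum !big_ord_recl big_ord0 /=.
by case: i => [[|[|[|[|]]]]].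
Qed.

Section VertexCover.
Variables (G : sgraph) (C : {set G}).
Hypothesis G_conn : gconnected G.
Hypothesis C_cover : independent (~: C).

Definition link (u v : G) : bool :=
  sedge u v || [exists w, [&& w \notin C, sedge u w & sedge w v]].

Lemma link_sym : symmetric link.
Proof.
move=> u v; rewrite /link sedge_sym; congr (_ || _); apply: eq_existsb => w.
by rewrite (sedge_sym w) (sedge_sym u) [sedge v w && _]andbC.
Qed.

Lemma cover_edge x y : x \notin C -> sedge x y -> y \in C.
Proof.
move=> xC; apply: contraTT => yC; move/forall_inP: C_cover => /(_ x).
by rewrite inE xC => /(_ isT)/forall_inP/(_ y); rewrite inE yC; apply.
Qed.

(** Without a crossing link, [A] together with the outside vertices adjacent to it would be closed
    under adjacency: the outside is independent, so a walk is outside [C] for one vertex at a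
    time. *)
Lemma link_cut (A : {set G}) a b : A \subset C -> a \in A -> b \in C -> b \notin A ->
  exists u v, [/\ u \in A, v \in C, v \notin A & link u v].
Proof.
move=> AC aA bC bA; apply/not_existsP => no_link.
have {}no_link u v : u \in A -> v \in C -> link u v -> v \in A.
  move=> uA vC uv; apply/negPn/negP => vA; apply: (no_link u).
  by exists v; split.
pose B := [pred x | (x \in A) || (x \notin C) && [exists u in A, sedge x u]].
have csym : connect_sym (@sedge G) by apply: sym_connect_sym; exact: sedge_sym.
have B_closed : closed (@sedge G) B.
  apply: intro_closed => // x y xy; rewrite !inE.
  have [yC|yC] := boolP (y \in C); last first.
    case/orP=> [xA|/andP[xC _]]; last by rewrite (cover_edge xC xy) in yC.
    by apply/orP; right; apply/existsP; exists x; rewrite xA sedge_sym.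
  case/orP=> [xA|/andP[xC /existsP[u /andP[uA xu]]]]; first by rewrite (no_link x y) // /link xy.
  rewrite (no_link u y) // /link; apply/orP; right; apply/existsP; exists x.
  by rewrite xC xy sedge_sym xu.
have := closed_connect B_closed (G_conn.2 a b).
by rewrite !inE aA bC (negPf bA).
Qed.

Lemma gdeg_gt0 (x : G) : (1 < #|C|)%N -> (0 < gdeg x)%N.
Proof.
move=> C_gt1; apply/card_gt0P.
have [y yx] : exists y, y != x.
  have : (0 < #|C :\ x|)%N by have := cardsD1 x C; case: (x \in C); lia.
  by case/card_gt0P => y; rewrite !inE => /andP[yx _]; exists y.
have /connectP[[|z r]] := G_conn.2 x y; first by move=> _ /= yx'; rewrite yx' eqxx in yx.
by case/andP=> xz _ _; exists z; rewrite inE.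
Qed.

Let linker v z w := sedge v w && ((w == z) || (w \notin C) && sedge w z).

Let link_linker v z : link v z -> exists w, linker v z w.
Proof.
case/orP=> [vz|/existsP[w /and3P[wC vw wz]]].
  by exists z; rewrite /linker vz eqxx.
by exists w; rewrite /linker vw wC wz orbT.
Qed.

(** A neighbour of [v] serving both links would lie outside [C], because [a] and [b] are distinct
    members of [C], and would then link [a] to [b]. *)
Let linker_neq v a b w w' : a \in C -> b \in C -> a != b -> ~~ link a b ->
  linker v a w -> linker v b w' -> w != w'.
Proof.
move=> aC bC ab nab /andP[_ wa] /andP[_ wb]; apply/eqP => ww; rewrite -{}ww in wb.
case/orP: wa => [/eqP wa|/andP[wC wa]]; case/orP: wb => [/eqP wb|/andP[wC' wb]].
- by rewrite -wa -wb eqxx in ab.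
- by rewrite wa aC in wC'.
- by rewrite wb bC in wC.
by case/negP: nab; apply/orP; right; apply/existsP; exists w; rewrite wC sedge_sym wa.
Qed.

Lemma gdeg_ge2 (v a b : G) : a \in C -> b \in C -> a != b -> ~~ link a b ->
  link v a -> link v b -> (2 <= gdeg v)%N.
Proof.
move=> aC bC ab nab /link_linker[w wa] /link_linker[w' wb].
have ww := linker_neq aC bC ab nab wa wb.
apply: (@leq_trans #|[set w; w']|); first by rewrite cards2 ww.
apply/subset_leq_card/subsetP => z; rewrite !inE.
by case/andP: wa => vw _; case/andP: wb => vw' _; case/orP=> /eqP->.
Qed.

Lemma gdeg_ge3 (v a b c : G) : a \in C -> b \in C -> c \in C -> a != b -> a != c -> b != c ->
  ~~ link a b -> ~~ link a c -> ~~ link b c ->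
  link v a -> link v b -> link v c -> (3 <= gdeg v)%N.
Proof.
move=> aC bC cC ab ac bc nab nac nbc /link_linker[w wa] /link_linker[w' wb] /link_linker[w'' wc].
have h1 := linker_neq aC bC ab nab wa wb; have h2 := linker_neq aC cC ac nac wa wc.
have h3 := linker_neq bC cC bc nbc wb wc.
apply: (@leq_trans #|w |: [set w'; w'']|).
  by rewrite cardsU1 cards2 h3 !inE negb_or h1 h2.
apply/subset_leq_card/subsetP => z; rewrite !inE.
case/andP: wa => vw _; case/andP: wb => vw' _; case/andP: wc => vw'' _.
by case/or3P=> /eqP->.
Qed.

(** The degree condition concerns [v] alone; at the other vertices of the cover of a minimizer it
    will follow from the degree bound. *)
Definition spanning_links (v : G) (K : sgraph) (phi : K -> G) : Prop :=
  [/\ injective phi, forall i, phi i \in C, forall i j, sedge i j -> link (phi i) (phi j)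
    & forall i, phi i = v -> (gdeg i <= gdeg v)%N].

Ltac perm_tac := apply/permP => P /=; do 4! move: (nat_of_bool _); clear; lia.

Section TreeChoice.
Variable v : G.
Hypothesis C_card : #|C| = 4%N.

Let goal := (exists phi : K13 -> G, spanning_links v phi) \/
            (exists phi : P4 -> G, spanning_links v phi).

Let star_goal x y z c : uniq [:: x; y; z; c] -> all [in C] [:: x; y; z; c] ->
  link x c -> link y c -> link z c -> (v = c -> 3 <= gdeg v)%N -> goal.
Proof.
move=> t_uniq /all_nthP tC xc yc zc vc; left.
exists (fun i : 'I_4 => nth v [:: x; y; z; c] i); split=> [i j /eqP|i|i j|i iv].
- by rewrite nth_uniq // => /eqP/val_inj.
- exact: tC.
- have cx := xc; have cy := yc; have cz := zc; rewrite link_sym in cx.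
  rewrite link_sym in cy; rewrite link_sym in cz.
  by case: i => [[|[|[|[|i]]]] hi] //; case: j => [[|[|[|[|j]]]] hj].
rewrite K13_gdeg; case: eqP => [i3|_]; last by apply: gdeg_gt0; rewrite C_card.
by rewrite i3 /= in iv; exact: vc.
Qed.

Let path_goal x y z w : uniq [:: x; y; z; w] -> all [in C] [:: x; y; z; w] ->
  link x y -> link y z -> link z w -> (v = y \/ v = z -> 2 <= gdeg v)%N -> goal.
Proof.
move=> t_uniq /all_nthP tC xy yz zw vyz; right.
exists (fun i : 'I_4 => nth v [:: x; y; z; w] i); split=> [i j /eqP|i|i j|i iv].
- by rewrite nth_uniq // => /eqP/val_inj.
- exact: tC.
- have yx := xy; have zy := yz; have wz := zw; rewrite link_sym in yx.
  rewrite link_sym in zy; rewrite link_sym in wz.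
  by case: i => [[|[|[|[|i]]]] hi] //; case: j => [[|[|[|[|j]]]] hj].
rewrite P4_gdeg; case: ifP => [_|]; first by apply: gdeg_gt0; rewrite C_card.
case: i iv => [[|[|[|[|i]]]] hi] //= iv _; apply: vyz; first by left.
by right.
Qed.

Let perm_goal (s t : seq G) : perm_eq s t -> uniq t /\ all [in C] t -> uniq s /\ all [in C] s.
Proof. by move=> st; rewrite (perm_uniq st) (perm_all _ st). Qed.

Let two_links a b c : uniq [:: v; a; b; c] /\ all [in C] [:: v; a; b; c] ->
  link a b -> link b c -> link v a || link v b || link v c -> goal.
Proof.
move=> vabc ab bc; have [/= /and4P[va ab' bc' _] _] := vabc.
have [nva nvb nvc] : [/\ v <> a, v <> b & v <> c].
  by move: va; rewrite !inE !negb_or => /and3P[/eqP ? /eqP ? /eqP ?].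
case/orP=> [/orP[]|] vx.
- have [u t] := vabc; apply: (path_goal u t) => //; by case.
- have [u t] : uniq [:: v; a; c; b] /\ all [in C] [:: v; a; c; b].
    by apply: perm_goal vabc; rewrite perm_cons (perm_cons a) (perm_catC [:: c] [:: b]).
  by apply: (star_goal u t) => //; rewrite link_sym.
have [u t] : uniq [:: v; c; b; a] /\ all [in C] [:: v; c; b; a].
  apply: (perm_goal _ vabc); perm_tac.
apply: (path_goal u t) => //; try by rewrite link_sym.
by case.
Qed.

Let one_link a b c : uniq [:: v; a; b; c] /\ all [in C] [:: v; a; b; c] ->
  link v a -> link a b -> link v c -> ~~ link a c -> goal.
Proof.
move=> vabc va ab vc nac; have [/= /and4P[_ ab' bc' _] /and5P[vC aC bC cC _]] := vabc.
have ac' : a != c by move: ab'; rewrite !inE negb_or => /andP[].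
have [u t] : uniq [:: c; v; a; b] /\ all [in C] [:: c; v; a; b].
  by apply: (perm_goal _ vabc); perm_tac.
apply: (path_goal u t) => //; first by rewrite link_sym.
by move=> _; exact: (gdeg_ge2 aC cC).
Qed.

Let cut1 x y z t : uniq [:: x; y; z; t] -> C =i [:: x; y; z; t] ->
  [|| link x y, link x z | link x t].
Proof.
move=> /= /and4P[xyzt _ _ _] CE.
have xC : x \in C by rewrite CE inE eqxx.
have yC : y \in C by rewrite CE !inE eqxx orbT.
have yx : y \notin [set x] by rewrite inE; apply: contraNneq xyzt => ->; rewrite inE eqxx.
have [|u [w [/set1P-> + wx]]] := link_cut _ (set11 x) yC yx; first by rewrite sub1set.
move: wx; rewrite CE !inE => /negPf-> /= /or3P[]/eqP-> -> //; by rewrite ?orbT.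
Qed.

Let cut2 x y z t : uniq [:: x; y; z; t] -> C =i [:: x; y; z; t] ->
  [|| link x z, link x t, link y z | link y t].
Proof.
move=> /= /and4P[xyzt yzt _ _] CE.
have xC : x \in C by rewrite CE inE eqxx.
have yC : y \in C by rewrite CE !inE eqxx orbT.
have zC : z \in C by rewrite CE !inE eqxx !orbT.
have zxy : z \notin [set x; y].
  rewrite !inE negb_or; apply/andP; split.
    by apply: contraNneq xyzt => ->; rewrite !inE eqxx orbT.
  by apply: contraNneq yzt => ->; rewrite !inE eqxx.
have [|u [w [uxy wC wxy uw]]] := link_cut _ (set21 x y) zC zxy.
  by apply/subsetP => u; rewrite !inE => /orP[]/eqP->.
move: wC wxy uw uxy; rewrite CE !inE.
case/or4P=> /eqP->; rewrite ?eqxx ?orbT //= => _ uw /orP[]/eqP u_eq;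
  by rewrite u_eq in uw; rewrite uw ?orbT.
Qed.

Let no_link a b c : uniq [:: v; a; b; c] -> C =i [:: v; a; b; c] ->
  ~~ link a b -> ~~ link a c -> ~~ link b c -> goal.
Proof.
move=> u CE nab nac nbc.
have t : all [in C] [:: v; a; b; c] by apply/allP => x; rewrite CE.
have [/= /and4P[va ab' bc' _] /and5P[vC aC bC cC _]] := conj u t.
have {}ab' : a != b /\ a != c by move: ab'; rewrite !inE negb_or => /andP[].
have {}bc' : b != c by move: bc'; rewrite inE.
have perm s : perm_eq s [:: v; a; b; c] -> uniq s /\ C =i s.
  move=> st; split; first by rewrite (perm_uniq st).
  by move=> x; rewrite CE (perm_mem st).
have [ua Ca] : uniq [:: a; v; b; c] /\ C =i [:: a; v; b; c] by apply: perm; perm_tac.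
have [ub Cb] : uniq [:: b; v; a; c] /\ C =i [:: b; v; a; c] by apply: perm; perm_tac.
have [uc Cc] : uniq [:: c; v; a; b] /\ C =i [:: c; v; a; b] by apply: perm; perm_tac.
have av : link a v by have := cut1 ua Ca; rewrite (negPf nab) (negPf nac) !orbF.
have bv : link b v by have := cut1 ub Cb; rewrite (link_sym b a) (negPf nab) (negPf nbc) !orbF.
have cv : link c v.
  by have := cut1 uc Cc; rewrite !(link_sym c) (negPf nac) (negPf nbc) !orbF.
have [uv tv] : uniq [:: a; b; c; v] /\ all [in C] [:: a; b; c; v].
  by apply: (perm_goal _ (conj u t)); perm_tac.
apply: (star_goal uv tv) => // _.
rewrite link_sym in av; rewrite link_sym in bv; rewrite link_sym in cv.
exact: (gdeg_ge3 aC bC cC ab'.1 ab'.2 bc' nab nac nbc av bv cv).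
Qed.

Let lone_link a b c : uniq [:: v; a; b; c] -> C =i [:: v; a; b; c] ->
  link a b -> ~~ link a c -> ~~ link b c -> goal.
Proof.
move=> u CE ab nac nbc.
have t : all [in C] [:: v; a; b; c] by apply/allP => x; rewrite CE.
have perm s : perm_eq s [:: v; a; b; c] -> uniq s /\ C =i s.
  move=> st; split; first by rewrite (perm_uniq st).
  by move=> x; rewrite CE (perm_mem st).
have [uc Cc] : uniq [:: c; v; a; b] /\ C =i [:: c; v; a; b] by apply: perm; perm_tac.
have vc : link v c.
  by have := cut1 uc Cc; rewrite !(link_sym c) (negPf nac) (negPf nbc) !orbF.
have := cut2 uc Cc; rewrite !(link_sym c) (negPf nac) (negPf nbc) /= => /orP[va|vb].
  exact: (one_link (conj u t)).
have ut : uniq [:: v; b; a; c] /\ all [in C] [:: v; b; a; c].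
  by apply: (perm_goal _ (conj u t)); perm_tac.
by apply: (one_link ut); rewrite // link_sym.
Qed.

(** The cases count the links among the three other vertices. With at least two, these vertices form
    a path to which [v] is attached as a leaf. With one or none, cuts force [v] to be linked to two
    or three mutually unlinked vertices; these links use distinct neighbours of [v], so its degree
    allows it to be an inner vertex of a path or the centre of a star. *)
Lemma tree_choice : v \in C -> goal.
Proof.
move=> vC; have [s] : exists s, perm_eq s (enum C) /\ head v s = v.
  exists (v :: rem v (enum C)); split=> //.
  by rewrite perm_sym; apply: perm_to_rem; rewrite mem_enum.
case=> s_enum s_v; have := perm_size s_enum; rewrite -cardE C_card.
case: s s_enum s_v => [|v' [|a [|b [|c []]]]] // s_enum /= v'v _; rewrite {}v'v in s_enum.
have u : uniq [:: v; a; b; c] by rewrite (perm_uniq s_enum) enum_uniq.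
have CE : C =i [:: v; a; b; c] by move=> x; rewrite (perm_mem s_enum) mem_enum.
have perm s : perm_eq s [:: v; a; b; c] -> uniq s /\ C =i s.
  move=> st; split; first by rewrite (perm_uniq st).
  by move=> x; rewrite CE (perm_mem st).
have [u2 C2] : uniq [:: v; b; a; c] /\ C =i [:: v; b; a; c] by apply: perm; perm_tac.
have [u3 C3] : uniq [:: v; a; c; b] /\ C =i [:: v; a; c; b] by apply: perm; perm_tac.
have [u4 C4] : uniq [:: v; b; c; a] /\ C =i [:: v; b; c; a] by apply: perm; perm_tac.
have tC s : C =i s -> all [in C] s by move=> sE; apply/allP => x; rewrite sE.
have cv := cut1 u CE.
have [ab|nab] := boolP (link a b); have [ac|nac] := boolP (link a c);
  have [bc|nbc] := boolP (link b c).
- by apply: (two_links (conj u (tC _ CE))); rewrite // -orbA.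
- apply: (two_links (conj u2 (tC _ C2)) _ ac); first by rewrite link_sym.
  by move: cv => /or3P[]->; rewrite ?orbT.
- by apply: (two_links (conj u (tC _ CE))); rewrite // -orbA.
- exact: lone_link u CE ab nac nbc.
- apply: (two_links (conj u3 (tC _ C3)) ac); first by rewrite link_sym.
  by move: cv => /or3P[]->; rewrite ?orbT.
- by apply: (lone_link u3 C3); rewrite // link_sym.
- by apply: (lone_link u4 C4); rewrite // link_sym.
- exact: no_link u CE nab nac nbc.
Qed.

End TreeChoice.
End VertexCover.
(** * The structure of a minimizer *)

Section PerronLocal.
Variables (R : realType) (s l : R) (G : sgraph) (x : G -> R).
Hypothesis s_bnd : 0 < s < 1.
Hypothesis x_gt0 : forall v, 0 < x v.
Hypothesis xE : forall v, A_op s x v = l * x v.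

Lemma eigen_nbs w : (1 - s) * \sum_(v in nbs w) x v = (l - s * (gdeg w)%:R) * x w.
Proof.
rewrite [RHS]mulrBl -xE A_opE.
by rewrite addrAC subrr add0r; congr (_ * _); apply: eq_bigl => v; rewrite in_nbs.
Qed.

Lemma eigen_sub_nbs w (D : {set G}) : D \subset nbs w ->
  (1 - s) * \sum_(v in D) x v <= (l - s * (gdeg w)%:R) * x w
    ?= iff (D == nbs w).
Proof.
move=> DN; have /andP[_ s_lt1] := s_bnd; rewrite -eigen_nbs.
apply/leifP; have [->|ne_DN] := eqVneq D (nbs w); first by [].
rewrite ltr_pM2l ?subr_gt0 // [ltRHS](big_setID D) /= (setIidPr DN) ltrDl.
have [z zND] : exists z, z \in nbs w :\: D.
  by apply/set0Pn; apply: contraNneq ne_DN => /eqP; rewrite setD_eq0 eqEsubset DN.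
rewrite (bigD1 z) //= ltr_wpDr // sumr_ge0 // => v _; exact: ltW.
Qed.

Lemma eigen_gdeg_lt (w : G) : (0 < gdeg w)%N -> s * (gdeg w)%:R < l.
Proof.
move=> /card_gt0P[z wz]; have /andP[_ s_lt1] := s_bnd; rewrite -subr_gt0.
rewrite -(pmulr_lgt0 _ (x_gt0 w)) -eigen_nbs mulr_gt0 ?subr_gt0 //.
by rewrite (bigD1 z) //= ltr_wpDr // sumr_ge0 // => v _; exact: ltW.
Qed.

(* Each neighbour of [w] contributes at least as much as a pendant vertex would. *)
Lemma eigen_gdeg_ge (w : G) : (0 < gdeg w)%N ->
  (gdeg w)%:R * (s + (1 - s) ^+ 2 / (l - s)) <= l.
Proof.
move=> w_gt0; have /andP[s_gt0 s_lt1] := s_bnd.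
have ls : 0 < l - s.
  rewrite subr_gt0; apply: le_lt_trans (eigen_gdeg_lt w_gt0).
  by rewrite ler_peMr ?ler1n // ltW.
have nb_ge z : sedge w z -> (1 - s) ^+ 2 / (l - s) * x w <= (1 - s) * x z.
  move=> wz; have z_gt0 : (0 < gdeg z)%N by apply/card_gt0P; exists w; rewrite inE sedge_sym.
  have wN : [set w] \subset nbs z by rewrite sub1set in_nbs sedge_sym.
  have h : (1 - s) * x w <= (l - s) * x z.
    have [+ _] := eigen_sub_nbs wN; rewrite big_set1 => /le_trans; apply.
    by apply: ler_wpM2r; [exact: ltW|rewrite lerD2l lerN2 ler_peMr ?ler1n // ltW].
  have -> : (1 - s) ^+ 2 / (l - s) * x w = (1 - s) / (l - s) * ((1 - s) * x w) by ring.
  have -> : (1 - s) * x z = (1 - s) / (l - s) * ((l - s) * x z).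
    by field; rewrite gt_eqF.
  by rewrite ler_wpM2l // divr_ge0 ?subr_ge0 // ltW // -subr_gt0.
rewrite -(ler_pM2r (x_gt0 w)) -xE A_opE mulrDr mulrDl.
rewrite [_%:R * s]mulrC lerD2l mulr_sumr -mulrA mulr_natl.
rewrite /gdeg -sumr_const big_mkcond [leRHS]big_mkcond; apply: ler_sum => z _.
by rewrite inE; case: ifP => // /nb_ge.
Qed.

End PerronLocal.

(** * The degree bound for minimizers *)

Section Minimizer.
Variables (R : realType) (s l : R) (n : nat) (G : sgraph) (x : G -> R).
Hypothesis s_bnd : 2^-1 <= s < 1.
Hypothesis n_ge : (12 <= n)%N.
Hypothesis G_fam : in_family n (n - 4) G.
Hypothesis x_gt0 : forall v, 0 < x v.
Hypothesis xE : forall v, A_op s x v = l * x v.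
Hypothesis l_min : forall (H : sgraph) (y : H -> R), in_family n (n - 4) H ->
  (forall u, 0 < y u) -> (forall u, A_op s y u <= l * y u) ->
  forall u, A_op s y u = l * y u.

Let s_gt0 : 0 < s.
Proof. by have /andP[s_ge _] := s_bnd; apply: lt_le_trans s_ge; rewrite invr_gt0. Qed.

Let s_lt1 : s < 1. Proof. by case/andP: s_bnd. Qed.

Let s_bnd' : 0 < s < 1. Proof. by rewrite s_gt0 s_lt1. Qed.

Lemma minimizer_core_op (K : sgraph) (p : K -> nat) (X : K -> R) :
  skeleton K -> (\sum_i p i = n - 7)%N -> 2 * s < l -> (forall i, 0 < X i) ->
  (forall i, core_op s l p X i <= l * X i) -> forall i, core_op s l p X i = l * X i.
Proof.
move=> K_skel p_sum l2s X_gt0 X_le i.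
have n8 : (8 <= n)%N by exact: leq_trans n_ge.
have c_gt0 : 0 < 1 - s by rewrite subr_gt0.
have ls : 0 < l - s by move: s_gt0 l2s; lra.
pose y := core_extension s l (p := p) X.
have y_gt0 u : 0 < y u.
  case: (caterpillarP u) => [j|e|j k] //=; last by rewrite mulr_gt0 ?divr_gt0.
  rewrite mulr_gt0 ?divr_gt0 // ?subr_gt0 //.
  have [a [b [_ eE]]] := edgeP e; rewrite (bigD1 a) /=; last by rewrite eE set21.
  by rewrite ltr_wpDr // sumr_ge0 // => j _; exact: ltW.
have y_le u : A_op s y u <= l * y u.
  case: (caterpillarP u) => [j|e|j k]; first by rewrite A_op_core; exact: X_le.
    by rewrite A_op_noncore // ltW.
  by rewrite A_op_noncore // ltW.
have := l_min (caterpillar_in_family K_skel n8 p_sum) y_gt0 y_le (core p i).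
by rewrite A_op_core.
Qed.

(** A vertex of degree above [M] forces [l] to be at least [M + 1] times the value of a pendant
    edge. The constant vector on a subdivided path with all core degrees at most [M] is then strict
    at every core vertex, against minimality. *)
Lemma minimizer_gdeg_le (M : nat) (w : G) : (n - 1 <= 4 * M)%N -> (gdeg w <= M)%N.
Proof.
move=> nM; rewrite leqNgt; apply/negP => M_lt.
have M_ge3 : (3 <= M)%N by move: n_ge; lia.
have w_gt0 : (0 < gdeg w)%N by exact: leq_trans M_lt.
have ls : s < l.
  by apply: le_lt_trans (eigen_gdeg_lt s_bnd' x_gt0 xE w_gt0); rewrite ler_peMr ?ler1n // ltW.
have P_gt0 : 0 < (1 - s) ^+ 2 / (l - s) by rewrite divr_gt0 ?exprn_gt0 ?subr_gt0.
have M_le : (M%:R + 1) * (s + (1 - s) ^+ 2 / (l - s)) <= l.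
  apply: le_trans (eigen_gdeg_ge s_bnd' x_gt0 xE w_gt0).
  by rewrite natr1 ler_pM2r ?ler_nat // addr_gt0.
have l2s : 2 * s < l.
  apply: le_lt_trans (eigen_gdeg_lt s_bnd' x_gt0 xE w_gt0).
  rewrite mulrC ler_pM2l // (ler_nat _ 2); move: M_lt M_ge3; lia.
have gdeg_le2 (i : P4) : (gdeg i <= 2)%N by rewrite P4_gdeg; case: ifP.
have [|p p_le p_sum] := @exists_le_sum P4 (fun i => M - gdeg i)%N (n - 7).
  rewrite sumnB => [|i _]; last exact: leq_trans (gdeg_le2 i) (ltnW M_ge3).
  (* The path uses 6 of the total degree [4 * M], leaving at least (n - 1) - 6 = n - 7 for pendant
     edges. *)
  have -> : (\sum_(i : P4) M = 4 * M)%N by rewrite sum_nat_const card_ord.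
  by rewrite (skeleton_gdeg P4_skeleton); move: nM n_ge; lia.
have core_lt (i : P4) : core_op s l p (fun=> 1) i < l.
  rewrite /core_op sumr_const -[X in _ *+ X](_ : gdeg i = _); last by rewrite /gdeg cardsE.
  rewrite !mulr1 -[_ *+ gdeg i]mulr_natl -[1 + 1](_ : 2 = _ :> R); last by ring.
  apply: (@path_test_lt R s l _ _ M%:R) => //.
  - by case/andP: s_bnd.
  - by rewrite (ler_nat _ 3).
  - by rewrite ler0n (ler_nat _ _ 2) gdeg_le2.
  - rewrite -natrD ler_nat; have := p_le i; have := gdeg_le2 i; lia.
have core_eq (i : P4) : core_op s l p (fun=> 1) i = l * 1.
  apply: (minimizer_core_op (X := fun=> 1) P4_skeleton p_sum l2s) => // j.
  by rewrite mulr1; exact/ltW/core_lt.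
by have := core_lt (ord0 : P4); rewrite core_eq mulr1 ltxx.
Qed.

End Minimizer.

(** * Rigidity: a minimizer compared with its subdivided skeleton *)

Section SkeletonOfMinimizer.
Variables (R : realType) (s l : R) (n : nat) (G : sgraph) (x : G -> R).
Hypothesis s_bnd : 2^-1 <= s < 1.
Hypothesis n_ge : (12 <= n)%N.
Hypothesis G_fam : in_family n (n - 4) G.
Hypothesis x_gt0 : forall v, 0 < x v.
Hypothesis xE : forall v, A_op s x v = l * x v.
Hypothesis l_min : forall (H : sgraph) (y : H -> R), in_family n (n - 4) H ->
  (forall u, 0 < y u) -> (forall u, A_op s y u <= l * y u) ->
  forall u, A_op s y u = l * y u.

Variables (C : {set G}) (v : G).
Hypothesis C_cover : independent (~: C).
Hypothesis C_card : #|C| = 4%N.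
Hypothesis vC : v \in C.
Hypothesis v_min : forall u, u \in C -> (gdeg v <= gdeg u)%N.

Variables (K : sgraph) (ch pa : 'I_3 -> K) (rk : K -> nat) (phi : K -> G).
Hypothesis K_skel : skeleton K.
Hypothesis K_enum : edge_enum ch pa rk.
Hypothesis phi_links : spanning_links C v phi.

Let s_gt0 : 0 < s.
Proof. by have /andP[s_ge _] := s_bnd; apply: lt_le_trans s_ge; rewrite invr_gt0. Qed.

Let s_lt1 : s < 1. Proof. by case/andP: s_bnd. Qed.

Let s_bnd' : 0 < s < 1. Proof. by rewrite s_gt0 s_lt1. Qed.

Let G_conn : gconnected G. Proof. by case: G_fam. Qed.

Let phi_inj : injective phi. Proof. by case: phi_links. Qed.

Let phi_C i : phi i \in C. Proof. by case: phi_links. Qed.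

Let phi_onto u : u \in C -> exists i, u = phi i.
Proof.
have phiC : [set phi i | i : K] = C.
  apply/eqP; rewrite eqEcard card_imset // C_card.
  have -> : #|[pred _ : K | true]| = 4%N by rewrite -(skeleton_card K_skel).
  by rewrite leqnn andbT; apply/subsetP => _ /imsetP[i _ ->].
by rewrite -phiC => /imsetP[i _ ->]; exists i.
Qed.

Let sum_C (F : G -> nat) : (\sum_(u in C) F u = \sum_i F (phi i))%N.
Proof.
rewrite -(big_imset F (in2W phi_inj)) /=; apply: eq_bigl => u.
by apply/idP/imsetP => [/phi_onto[i ->]|[i _ ->]]; first by exists i.
Qed.

Let d i := gdeg (phi i).
Let D i j := sedge (phi i) (phi j).
(** [DD] counts every edge inside [C] twice, while [X] counts once the tree edges that are
    themselves edges of [G]. *)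
Let DD := (\sum_i \sum_j D i j)%N.
Let X := (\sum_k D (ch k) (pa k))%N.

Let D_sym i j : D i j = D j i. Proof. exact: sedge_sym. Qed.

(** The neighbour of [phi i] charged with the tree edge from [i] to [j]; an edge of [G] takes
    precedence over a common neighbour. The default does not occur on tree edges. *)
Definition linker (i j : K) : G :=
  if sedge (phi i) (phi j) then phi j
  else odflt (phi j) [pick w | [&& w \notin C, sedge (phi i) w & sedge w (phi j)]].

Let W := linker.

Let W_direct i j : D i j -> W i j = phi j.
Proof. by rewrite /W /linker /D => ->. Qed.

Let W_indirect i j : sedge i j -> ~~ D i j ->
  [/\ W i j \notin C, sedge (phi i) (W i j) & sedge (W i j) (phi j)].
Proof.
move=> ij nD; have [_ _ links _] := phi_links.
have := links i j ij; rewrite /link /W /linker -/(D i j) (negPf nD) /= => /existsP[w wP].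
by case: pickP => [w' /and3P[]|/(_ w)] //; rewrite wP.
Qed.

Let W_edge i j : sedge i j -> sedge (phi i) (W i j).
Proof.
move=> ij; have [Dij|/(W_indirect ij)[]//] := boolP (D i j).
by rewrite W_direct.
Qed.

(** The tree edges charged to [w] form a forest whose vertices are neighbours of [w], and a nonempty
    forest has more vertices than edges: the children are distinct, and the parent of the child of
    highest rank is none of them. *)
Let indirect_card w : w \notin C ->
  (1 + \sum_k (~~ D (ch k) (pa k) && (W (ch k) (pa k) == w)) <= gdeg w)%N.
Proof.
move=> wC; pose A := [set k | ~~ D (ch k) (pa k) && (W (ch k) (pa k) == w)].
have [ch_inj ch_edge rk_lt _] := K_enum.
have -> : (\sum_k (~~ D (ch k) (pa k) && (W (ch k) (pa k) == w)) = #|A|)%N.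
  by rewrite -sum1_card [RHS]big_mkcond; apply: eq_bigr => k _; rewrite inE; case: (_ && _).
have AE k : k \in A -> sedge w (phi (ch k)) /\ sedge w (phi (pa k)).
  rewrite inE => /andP[/(W_indirect (ch_edge k))[_ e1 e2] /eqP <-].
  by rewrite sedge_sym.
have [->|[k0 k0A]] := set_0Vmem A.
  rewrite cards0 addn0; have C1 : (1 < #|C|)%N by rewrite C_card.
  exact: (gdeg_gt0 G_conn C_cover w C1).
case: (@arg_maxnP _ k0 (mem A) (fun k => rk (ch k)) k0A) => k kA k_max.
have pa_ch k' : k' \in A -> pa k != ch k'.
  move=> /k_max k'_le; apply/eqP => pk; have := rk_lt k; rewrite pk => lt_k.
  by have := leq_trans lt_k k'_le; rewrite ltnn.
have -> : (1 + #|A| = #|phi (pa k) |: [set phi (ch k) | k in A]|)%N.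
  rewrite cardsU1 (card_imset _ (inj_comp phi_inj ch_inj)); congr (_ + _)%N.
  rewrite (_ : _ \in _ = false) //; apply/imsetP => -[k' k'A /phi_inj pk].
  by have := pa_ch k' k'A; rewrite pk eqxx.
apply: subset_leq_card; apply/subsetP => u; rewrite !inE.
by case/orP=> [/eqP->|/imsetP[k' /AE[e1 _] ->]] //; have [] := AE _ kA.
Qed.

(** The edges leaving [C] are counted from outside: n - 4 vertices with at least one each, and one
    more for each of the 3 - [X] tree edges realized by an outside vertex. *)
Let sum_gdeg : (n - 1 + DD <= \sum_i d i + X)%N.
Proof.
have cardI : #|~: C| = (n - 4)%N.
  have [cardG _ _] := G_fam; have := cardsC C; rewrite cardG C_card; lia.
have d_split i : d i = (\sum_j D i j + \sum_(w in ~: C) sedge (phi i) w)%N.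
  rewrite /d gdeg_sum (bigID (mem C)) /= sum_C; congr (_ + _)%N.
  by apply: eq_bigl => w; rewrite inE.
under eq_bigr do rewrite d_split; rewrite big_split /= -/DD.
rewrite exchange_big /=.
have w_ge w : w \in ~: C -> (1 + \sum_k (~~ D (ch k) (pa k) && (W (ch k) (pa k) == w)) <=
    \sum_i sedge (phi i) w)%N.
  rewrite inE => wC; apply: leq_trans (indirect_card wC) _.
  rewrite gdeg_sum (bigID (mem C)) /= [X in (_ + X)%N]big1 => [|u uC]; last first.
    by apply/eqP; rewrite eqb0; apply: contraNN uC => /(cover_edge C_cover wC).
  by rewrite addn0 sum_C; apply: leq_sum => i _; rewrite sedge_sym.
have : (\sum_(w in ~: C) (1 + \sum_k (~~ D (ch k) (pa k) && (W (ch k) (pa k) == w))) <=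
    \sum_(w in ~: C) \sum_i sedge (phi i) w)%N by apply: leq_sum; exact: w_ge.
rewrite big_split /= sum1_card cardI exchange_big /=.
have -> : (\sum_k \sum_(w in ~: C) (~~ D (ch k) (pa k) && (W (ch k) (pa k) == w)) =
    \sum_k ~~ D (ch k) (pa k))%N.
  apply: eq_bigr => k _; have [_ ch_edge _ _] := K_enum.
  have [Dk|nDk] := boolP (D (ch k) (pa k)); first by rewrite big1.
  have [WC _ _] := W_indirect (ch_edge k) nDk.
  rewrite (bigD1 (W (ch k) (pa k))) ?inE //= eqxx big1 // => w /andP[_ ne].
  by rewrite eq_sym (negPf ne).
have : (\sum_k ~~ D (ch k) (pa k) + X = 3)%N.
  rewrite /X -big_split /= -[RHS]card_ord -sum1_card.
  by apply: eq_bigr => k _; case: (D _ _).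
by move: n_ge; lia.
Qed.

Let DD_ge : (2 * X <= DD)%N.
Proof.
have [_ _ _ sumE] := K_enum.
rewrite /X -(sumE (fun i j => D i j : nat)) => [|i j]; last by rewrite D_sym.
by apply: leq_sum => i _; rewrite big_mkcond; apply: leq_sum => j _; case: ifP.
Qed.

Let M := ((n + 2) %/ 4)%N.

Let d_le i : (d i <= M)%N.
Proof.
apply: (minimizer_gdeg_le s_bnd n_ge x_gt0 xE l_min); rewrite /M; lia.
Qed.

Let i0_exists : exists i, v = phi i. Proof. exact: phi_onto. Qed.

Section Root.
Variable i0 : K.
Hypothesis vE : v = phi i0.

Let d_min i : (d i0 <= d i)%N.
Proof. by rewrite /d -vE v_min. Qed.

Let sum_d_le i : i != i0 -> (\sum_j d j <= d i0 + d i + 2 * M)%N.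
Proof.
move=> ii0.
have h : (\sum_(j : K) (M - d j) = 4 * M - \sum_j d j)%N.
  by rewrite sumnB // sum_nat_const (skeleton_card K_skel).
have : (\sum_j d j <= 4 * M)%N.
  by rewrite -(skeleton_card K_skel) -sum_nat_const; apply: leq_sum => j _.
move: h; rewrite (bigD1 i0) //= (bigD1 i) //=.
by have := d_le i; have := d_le i0; lia.
Qed.

Let other_exists : exists i, i != i0.
Proof.
have : (0 < #|[set~ i0]|)%N by have := cardsC1 i0; rewrite (skeleton_card K_skel) => ->.
by case/card_gt0P=> i; rewrite !inE; exists i.
Qed.

(** The degree sum is at least n - 1 and at most [2 * d i + 2 * M]; for n >= 12 this gives
    [2 * d i >= 5]. *)
Let d_ge3 i : i != i0 -> (3 <= d i)%N.
Proof.
move/sum_d_le => le_d; have := d_min i; have := sum_gdeg; have := DD_ge.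
by rewrite leqNgt /M in le_d *; move: n_ge; lia.
Qed.

Let d_ge4 i : i != i0 -> (0 < DD)%N -> (d i0 <= 2)%N -> (4 <= d i)%N.
Proof.
move/sum_d_le => le_d DD_gt0 d0; have := sum_gdeg; have := DD_ge.
by rewrite /M in le_d *; move: n_ge; lia.
Qed.

Let d_ge2 i : (0 < DD)%N -> (2 <= d i)%N.
Proof.
move=> DD_gt0; apply: leq_trans (d_min i).
have [j /sum_d_le le_d] := other_exists; have := d_le j; have := sum_gdeg; have := DD_ge.
by rewrite /M in le_d *; move: n_ge; lia.
Qed.

(** Marks the edges of [G] to a root of degree at most 2. When such an edge realizes a tree edge,
    one unit of the degree of [phi i] is withheld from the pendant edges. *)
Let low i j := [&& j == i0, D i j & (d i0 <= 2)%N].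
Let lows i := (\sum_(j | sedge i j) low i j)%N.

Let lows_le1 i : (lows i <= 1)%N.
Proof.
rewrite /lows (bigID (pred1 i0)) /= [X in (_ + X)%N]big1 => [|j /andP[_ ne]]; last first.
  by rewrite /low (negPf ne).
rewrite addn0 big_mkcond (bigD1 i0) //= big1 => [|j ne]; last by rewrite (negPf ne) andbF.
by rewrite addn0 eqxx andbT; case: ifP => // _; case: (low _ _).
Qed.

Let lows_gt0 i : (0 < lows i)%N -> i != i0 /\ (0 < DD)%N /\ (d i0 <= 2)%N.
Proof.
rewrite lt0n sum_nat_eq0 negb_forall => /existsP[j]; rewrite negb_imply eqb0 negbK.
move=> /andP[ij /and3P[/eqP ji0 Dij d0]]; rewrite ji0 in ij Dij; split.
  by apply: contraTneq ij => ->; rewrite sedge_irr.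
by split=> //; rewrite /DD (bigD1 i) //= (bigD1 i0) //= Dij.
Qed.

Let gdegK_le3 (i : K) : (gdeg i <= 3)%N.
Proof.
have -> : 3%N = #|[set~ i]| by rewrite cardsC1 (skeleton_card K_skel).
apply/subset_leq_card/subsetP => j; rewrite !inE => ij.
by apply: contraTneq ij => ->; rewrite sedge_irr.
Qed.

Let room i : (lows i + gdeg i <= d i)%N.
Proof.
have [ii0|ii0] := eqVneq i i0.
  have : ~~ (0 < lows i)%N by apply/negP => /lows_gt0[]; rewrite ii0 eqxx.
  rewrite -leqNgt leqn0 => /eqP->; have [_ _ _] := phi_links.
  by rewrite add0n /d ii0 -vE; apply; rewrite vE.
have := lows_le1 i; have := gdegK_le3 i; have := d_ge3 ii0.
have [/lows_gt0[_ [DD_gt0 d0]]|] := ltnP 0 (lows i); last by lia.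
by have := d_ge4 ii0 DD_gt0 d0; lia.
Qed.

(** A tree edge at the root is charged only at its other end, whereas the symmetric double sum
    [2 * X] sees it from both. *)
Let sum_lows : (\sum_i lows i <= X)%N.
Proof.
pose Y i j := (sedge i j && D i j : nat).
have Y_sym i j : Y i j = Y j i by rewrite /Y sedge_sym D_sym.
have [_ ch_edge _ sumE] := K_enum.
have YE : (\sum_i \sum_j Y i j = 2 * X)%N.
  rewrite /X -(sumE (fun i j => D i j : nat)) => [|i j]; last by rewrite D_sym.
  apply: eq_bigr => i _; rewrite [RHS]big_mkcond; apply: eq_bigr => j _.
  by rewrite /Y; case: (sedge i j).
have lows_Y i : (lows i <= Y i i0)%N.
  rewrite /lows big_mkcond (bigD1 i0) //= big1 => [|j ne]; last first.
    by rewrite /low (negPf ne); case: ifP.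
  by rewrite addn0 /Y /low eqxx; case: (sedge i i0) => //=; case: (D i i0) => //=; case: (d i0 <= 2)%N.
have : (\sum_i lows i <= \sum_i Y i i0)%N by apply: leq_sum.
have : (\sum_j Y i0 j = \sum_i Y i i0)%N by apply: eq_bigr => i _; exact: Y_sym.
have : (\sum_(i | i != i0) Y i i0 <= \sum_(i | i != i0) \sum_j Y i j)%N.
  by apply: leq_sum => i _; rewrite [leqRHS](bigD1 i0) //= leq_addr.
have : (\sum_i Y i i0 = \sum_(i | i != i0) Y i i0)%N.
  by rewrite (bigD1 i0) //= /Y sedge_irr.
by move: YE; rewrite (bigD1 i0) //=; lia.
Qed.

(** The room left is at least (n - 1 + [DD] - [X]) - [X] - 6, and [2 * X <= DD]: half the bonus from
    inner edges is available for the withheld units. *)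
Lemma pendants_exist : exists2 p : K -> nat,
  (forall i, p i + lows i + gdeg i <= d i)%N & (\sum_i p i = n - 7)%N.
Proof.
have [|p p_le p_sum] := @exists_le_sum K (fun i => d i - (lows i + gdeg i))%N (n - 7).
  rewrite sumnB => [|i _]; last exact: room.
  rewrite big_split /= (skeleton_gdeg K_skel).
  by have := sum_lows; have := sum_gdeg; have := DD_ge; lia.
by exists p => // i; have := p_le i; have := room i; lia.
Qed.

Let P := (1 - s) ^+ 2 / (l - s).
Let Q := (1 - s) ^+ 2 / (l - 2 * s).
Let x_ i := x (phi i).

(* The surplus at [phi i] of the neighbour [w] over a pendant vertex and over
   the tree edges that [w] realizes. *)
Let surplus i w := (1 - s) * x w - P * x_ i -
  \sum_(j | sedge i j && (W i j == w))
    (Q * (x_ i + x_ j) - P * x_ i - (low i j)%:R * ((s + P) * x_ i)).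

Let sum_nb (H : sgraph) (i : H) (c : R) : \sum_(j | sedge i j) c = (gdeg i)%:R * c.
Proof. by rewrite sumr_const mulr_natl /gdeg cardsE. Qed.

Let sum_surplus (p : K -> nat) i : l * x_ i - core_op s l p x_ i =
  \sum_(w | sedge (phi i) w) surplus i w +
  ((d i)%:R - (p i + lows i + gdeg i)%:R) * ((s + P) * x_ i).
Proof.
rewrite /x_ -xE A_opE -/(x_ i) -/(d i) sumrB sumrB sum_nb.
rewrite -(partition_big (W i) (fun w => sedge (phi i) w)
  (F := fun j => Q * (x_ i + x_ j) - P * x_ i - (low i j)%:R * ((s + P) * x_ i)));
  last by move=> j /W_edge.
rewrite !sumrB sum_nb -mulr_suml /core_op big_split /= sum_nb -/P -/Q.
have -> : \sum_(j | sedge i j) (low i j)%:R = (lows i)%:R :> R by rewrite natr_sum.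
rewrite -!mulr_sumr -/(d i) !natrD.
by rewrite -/(x_ i); set A := \sum_(_ | _) x _; set B := \sum_(_ | _) _; ring.
Qed.

Let l_gt3s : 3 * s < l.
Proof.
have [i /d_ge3 d3] := other_exists.
apply: le_lt_trans (eigen_gdeg_lt s_bnd' x_gt0 xE (w := phi i) _).
  by rewrite mulrC ler_pM2l // (ler_nat _ 3).
exact: leq_trans d3.
Qed.

Let l_gt2s : 2 * s < l.
Proof. by have h := l_gt3s; have h' := s_gt0; lra. Qed.

Let l_gts : s < l.
Proof. by have h := l_gt3s; have h' := s_gt0; lra. Qed.

Let surplus_indirect i w : sedge (phi i) w -> w \notin C ->
  0 <= surplus i w /\ (surplus i w = 0 ->
    gdeg w = 1%N \/ gdeg w = 2%N /\ exists j, sedge i j /\ W i j = w).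
Proof.
move=> iw wC; pose J := [set j | sedge i j && (W i j == w)].
have JP j : j \in J -> [/\ sedge i j, W i j = w, ~~ D i j & sedge w (phi j)].
  rewrite inE => /andP[ij /eqP Ww]; have nD : ~~ D i j.
    by apply: contra wC => /W_direct; rewrite Ww => ->.
  by have [_ _] := W_indirect ij nD; rewrite Ww.
pose N := phi i |: [set phi j | j in J].
have iJ : phi i \notin [set phi j | j in J].
  by apply/imsetP => -[j /JP[ij _ _ _] /phi_inj ji]; rewrite ji sedge_irr in ij.
have N_sub : N \subset nbs w.
  apply/subsetP => u; rewrite !inE => /orP[/eqP->|/imsetP[j /JP[_ _ _ wj] ->]] //.
  by rewrite sedge_sym.
have N_card : #|N| = #|J|.+1 by rewrite cardsU1 iJ card_imset.
have J_lt : (#|J| < gdeg w)%N by rewrite -N_card; exact: subset_leq_card N_sub.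
have sum_N : \sum_(u in N) x u = x_ i + \sum_(j in J) x_ j.
  by rewrite big_setU1 //= big_imset //= => j k _ _; exact: phi_inj.
have surplusE : surplus i w = (1 - s) * x w - P * x_ i -
    (#|J|%:R * (Q - P) * x_ i + Q * \sum_(j in J) x_ j).
  rewrite /surplus; congr (_ - _).
  transitivity (\sum_(j in J) ((Q - P) * x_ i + Q * x_ j)).
    apply: eq_big => j; first by rewrite inE.
    move=> jJ; have /JP[_ _ nD _] : j \in J by rewrite inE.
    by rewrite /low (negPf nD) andbF mul0r subr0; ring.
  by rewrite big_split /= sumr_const -mulr_sumr -[_ *+ _]mulr_natl mulrA.
rewrite surplusE.
have [||||||||||T_ge0 T_eq0] := @indirect_ge0 R s l (x_ i) (\sum_(j in J) x_ j) (x w) (gdeg w) #|J|.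
- exact: s_gt0.
- exact: s_lt1.
- exact: l_gts.
- exact: l_gt2s.
- rewrite mulrC; apply: (eigen_gdeg_lt s_bnd' x_gt0 xE); exact: leq_ltn_trans J_lt.
- exact: J_lt.
- exact: x_gt0.
- by rewrite sumr_ge0 // => j _; exact/ltW/x_gt0.
- by move/eqP; rewrite cards_eq0 => /eqP->; rewrite big_set0.
- by rewrite -sum_N; exact: (eigen_sub_nbs s_bnd' x_gt0 xE N_sub).1.
split=> // /T_eq0[|[w2 J1]]; [by left|right; split=> //].
have /card_gt0P[j /JP[ij Ww _ _]] : (0 < #|J|)%N by rewrite J1.
by exists j.
Qed.

(** A neighbour in [C] is charged with at most the tree edge leading to it. Its degree is at least
    2, which makes its eigenvalue inequality strict; if it is exactly 2, the neighbour is the root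
    and the withheld unit compensates. *)
Let surplus_direct i j : D i j -> 0 < surplus i (phi j).
Proof.
move=> Dij.
have DD_gt0 : (0 < DD)%N by rewrite /DD (bigD1 i) //= (bigD1 j) //= Dij.
have dj2 := d_ge2 j DD_gt0.
have lt_j : (1 - s) * x_ i < (l - s * (d j)%:R) * x_ j.
  have N_sub : [set phi i] \subset nbs (phi j) by rewrite sub1set in_nbs sedge_sym.
  have := eigen_sub_nbs s_bnd' x_gt0 xE N_sub; rewrite big_set1 => /lt_leif ->.
  by apply: contraL dj2 => /eqP N_eq; rewrite /d /gdeg -/(nbs (phi j)) -N_eq cards1.
have fiberE k : sedge i k && (W i k == phi j) = (k == j) && sedge i j.
  apply/andP/andP => [[ik /eqP Wk]|[/eqP-> ij]]; last by rewrite ij W_direct.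
  have [Dik|nD] := boolP (D i k).
    by move: Wk; rewrite (W_direct Dik) => /phi_inj <-; rewrite eqxx.
  by have [WC _ _] := W_indirect ik nD; rewrite Wk phi_C in WC.
rewrite /surplus (eq_bigl _ _ fiberE).
have [ij|nij] := boolP (sedge i j); last first.
  rewrite big_pred0 => [|k]; last by rewrite andbF.
  rewrite subr0; apply: (direct_nonedge_gt0 s_lt1 s_gt0 l_gts (x_gt0 _) _ lt_j).
  by rewrite ler1n (leq_trans _ dj2).
rewrite (big_pred1 j) => [|k]; last by rewrite andbT.
have /andP[s_ge _] := s_bnd.
have [dj_le2|dj_ge3] := leqP (d j) 2.
  have ji0 : j = i0.
    by apply/eqP/negPn/negP => /d_ge3; rewrite leqNgt ltnS dj_le2.
  have -> : low i j by rewrite /low Dij ji0 eqxx -ji0.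
  have := @low_edge_gt0 R s l (x_ i) (x_ j) s_ge s_lt1 l_gt3s (x_gt0 _) (x_gt0 _).
  by rewrite -/P -/Q -/(x_ j) mul1r; congr (0 < _); ring.
have -> : low i j = false.
  by apply/negbTE; rewrite /low; apply/and3P => -[/eqP ji0 _]; rewrite -ji0 leqNgt dj_ge3.
have := @direct_edge_gt0 R s l (x_ i) (x_ j) (d j)%:R s_ge s_lt1 l_gt2s (x_gt0 _) _ lt_j.
rewrite (ler_nat _ 3) dj_ge3 => /(_ isT).
by rewrite -/P -/Q -/(x_ j) mul0r; congr (0 < _); ring.
Qed.

Let surplus_ge0 i w : sedge (phi i) w -> 0 <= surplus i w.
Proof.
move=> iw; have [/phi_onto[j wE]|wC] := boolP (w \in C).
  by rewrite wE; apply/ltW/surplus_direct; rewrite /D -wE.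
by have [] := surplus_indirect iw wC.
Qed.

Let surplus_eq0 i w : sedge (phi i) w -> surplus i w = 0.
Proof.
move=> iw; have [p p_le p_sum] := pendants_exist.
have S_gt0 j : 0 < (s + P) * x_ j.
  by rewrite mulr_gt0 ?x_gt0 // addr_gt0 // divr_gt0 ?exprn_gt0 ?subr_gt0.
have slack_ge0 j : 0 <= ((d j)%:R - (p j + lows j + gdeg j)%:R) * ((s + P) * x_ j).
  by apply: mulr_ge0; [rewrite subr_ge0 ler_nat|exact: ltW].
have core_le j : core_op s l p x_ j <= l * x_ j.
  by rewrite -subr_ge0 sum_surplus addr_ge0 // sumr_ge0 // => u; exact: surplus_ge0.
have core_eq := minimizer_core_op s_bnd n_ge l_min K_skel p_sum l_gt2s (fun j => x_gt0 (phi j)) core_le.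
have /eqP := sum_surplus p i; rewrite core_eq subrr eq_sym paddr_eq0 //; last first.
  by rewrite sumr_ge0 // => u; exact: surplus_ge0.
case/andP=> /eqP sum0 _.
have h := psumr_eq0P (fun u (iu : sedge (phi i) u) => surplus_ge0 iu) sum0.
exact: h.
Qed.

Let indep i j : ~~ D i j.
Proof.
by apply/negP => Dij; have := surplus_direct Dij; rewrite surplus_eq0 // ltxx.
Qed.

Let nb_cases i w : sedge (phi i) w -> gdeg w = 1%N \/
  gdeg w = 2%N /\ exists j, sedge i j /\ W i j = w.
Proof.
move=> iw; have wC : w \notin C.
  by apply/negP => /phi_onto[j wE]; have := indep i j; rewrite /D -wE iw.
by have [_] := surplus_indirect iw wC; apply; exact: surplus_eq0.
Qed.

Let nbs_eq w (N : {set G}) : N \subset nbs w -> #|N| = gdeg w -> nbs w = N.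
Proof. by move=> sub cardN; apply/eqP; rewrite eq_sym eqEcard sub cardN /=. Qed.

Let linker_nbs i j : sedge i j -> gdeg (W i j) = 2%N -> nbs (W i j) = [set phi i; phi j].
Proof.
move=> ij W2; have [_ iW Wj] := W_indirect ij (indep i j).
apply: nbs_eq; last first.
  by rewrite W2 cards2 (inj_eq phi_inj); case: eqP ij => // ->; rewrite sedge_irr.
by apply/subsetP => u; rewrite !inE => /orP[]/eqP-> //; rewrite sedge_sym.
Qed.

Lemma rooted_realizes : realizes phi.
Proof.
split=> [||w wN|i j ij].
- exact: phi_inj.
- exact: indep.
- have wC : w \notin C by apply: contra wN => /phi_onto[i ->]; exact: codom_f.
  have C1 : (1 < #|C|)%N by rewrite C_card.
  have /card_gt0P[z] := gdeg_gt0 G_conn C_cover w C1; rewrite inE => wz.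
  have /phi_onto[i zE] := cover_edge C_cover wC wz; rewrite {}zE sedge_sym in wz.
  have [w1|[w2 [j [ij WE]]]] := nb_cases wz; [left|right]; exists i.
    by apply: nbs_eq; rewrite ?w1 ?cards1 // sub1set in_nbs sedge_sym.
  by exists j; split=> //; rewrite -WE in w2 *; exact: linker_nbs.
have [_ iW Wj] := W_indirect ij (indep i j).
have ne_ij : phi i != phi j by rewrite (inj_eq phi_inj); case: eqP ij => // ->; rewrite sedge_irr.
have WN : nbs (W i j) = [set phi i; phi j].
  apply: linker_nbs => //; case: (nb_cases iW) => [W1|[]//].
  have : (#|[set phi i; phi j]| <= gdeg (W i j))%N.
    by apply/subset_leq_card/subsetP => u; rewrite !inE => /orP[]/eqP-> //; rewrite sedge_sym.
  by rewrite W1 cards2 ne_ij.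
(* A second vertex with this neighbourhood has degree 2, so it is again charged with a tree edge
   from [i], to some [k]; its neighbours force [k = j], hence it is [W i j]. *)
exists (W i j); split=> // w' w'N.
have iw' : sedge (phi i) w' by rewrite sedge_sym -in_nbs w'N set21.
have [w'1|[_ [k [ik Wk]]]] := nb_cases iw'.
  by move: w'1; rewrite /gdeg -/(nbs w') w'N cards2 ne_ij.
have [_ _ Wk'] := W_indirect ik (indep i k).
move: Wk'; rewrite Wk -in_nbs w'N !inE !(inj_eq phi_inj) => /orP[/eqP ki|/eqP kj].
  by rewrite ki sedge_irr in ik.
by rewrite -Wk kj.
Qed.

End Root.

Lemma minimizer_realizes : realizes phi.
Proof. by have [i0 vE] := i0_exists; exact: rooted_realizes vE. Qed.

End SkeletonOfMinimizer.
(** * The extremal quadruples *)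

(** Keeping the embedding instead of an isomorphism lets the automorphisms of the tree permute the
    pendant counts. *)
Definition star_rep (G : sgraph) (a b c d : nat) : Prop :=
  exists phi : K13 -> G, realizes phi /\
    forall i : 'I_4, pendant_nb (K := K13) phi i = nth 0%N [:: a; b; c; d] i.

Definition path_rep (G : sgraph) (a b c d : nat) : Prop :=
  exists phi : P4 -> G, realizes phi /\
    forall i : 'I_4, pendant_nb (K := P4) phi i = nth 0%N [:: a; b; c; d] i.

Lemma star_rep_giso G a b c d : star_rep G a b c d -> giso G (T1 a b c d).
Proof.
move=> [phi [phi_real pE]]; have := realizes_giso phi_real.
by rewrite (funext pE).
Qed.

Lemma path_rep_giso G a b c d : path_rep G a b c d -> giso G (T2 a b c d).
Proof.
move=> [phi [phi_real pE]]; have := realizes_giso phi_real.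
by rewrite (funext pE).
Qed.

Lemma star_rep_relabel G a b c d a' b' c' (tau : 'I_4 -> 'I_4) : injective tau ->
  (forall i : 'I_4, (tau i == 3 :> nat) = (i == 3 :> nat)) ->
  (forall i : 'I_4, nth 0%N [:: a; b; c; d] (tau i) = nth 0%N [:: a'; b'; c'; d] i) ->
  star_rep G a b c d -> star_rep G a' b' c' d.
Proof.
move=> tau_inj tau3 tauE [phi [phi_real pE]]; exists (phi \o tau); split.
  by apply: realizes_relabel => // i j; rewrite /= /star_edge !tau3.
by move=> i; rewrite -tauE -pE.
Qed.

Lemma star_rep_swap01 G a b c d : star_rep G a b c d -> star_rep G b a c d.
Proof.
apply: (@star_rep_relabel _ _ _ _ _ _ _ _ (tperm ord0 (lift ord0 ord0))).
- exact: perm_inj.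
- by move=> i; case: tpermP => [->|->|] //.
by move=> i; case: tpermP => [->|->|] //; case: i => [[|[|[|[|i]]]] hi] //= /eqP + /eqP.
Qed.

Lemma star_rep_swap12 G a b c d : star_rep G a b c d -> star_rep G a c b d.
Proof.
apply: (@star_rep_relabel _ _ _ _ _ _ _ _ (tperm (lift ord0 ord0) (lift ord0 (lift ord0 ord0)))).
- exact: perm_inj.
- by move=> i; case: tpermP => [->|->|] //.
by move=> i; case: tpermP => [->|->|] //; case: i => [[|[|[|[|i]]]] hi] //= /eqP + /eqP.
Qed.

Lemma star_rep_sort G a b c d : star_rep G a b c d ->
  exists a' b' c', star_rep G a' b' c' d /\ (a' <= b' <= c')%N.
Proof.
have swap01 := @star_rep_swap01 G; have swap12 := @star_rep_swap12 G => abc.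
case: (leqP a b) => ab; case: (leqP b c) => bc; case: (leqP a c) => ac.
- by exists a, b, c; rewrite ab bc.
- by exists a, b, c; rewrite ab bc.
- by exists a, c, b; rewrite ac (ltnW bc); split=> //; exact: swap12.
- by exists c, a, b; rewrite ab (ltnW ac); split=> //; apply/swap01/swap12.
- by exists b, a, c; rewrite ac (ltnW ab); split=> //; exact: swap01.
- by exists b, c, a; rewrite bc (ltnW ac); split=> //; apply/swap12/swap01.
- by exists c, b, a; rewrite (ltnW ab) (ltnW bc); split=> //; apply/swap01/swap12/swap01.
- by exists c, b, a; rewrite (ltnW ab) (ltnW bc); split=> //; apply/swap01/swap12/swap01.
Qed.

Lemma path_rep_rev G a b c d : path_rep G a b c d -> path_rep G d c b a.
Proof.
case=> phi [phi_real pE]; exists (phi \o @rev_ord 4); split.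
  apply: realizes_relabel phi_real => [|i j]; first exact: rev_ord_inj.
  have := ltn_ord i; have := ltn_ord j; rewrite /= /path_edge /=; lia.
move=> i; rewrite -[LHS]/(pendant_nb (K := P4) phi (rev_ord i)) pE /=.
by case: i => [[|[|[|[|i]]]] hi].
Qed.

Lemma star_rep_bounds (G : sgraph) M a b c d : (forall w : G, gdeg w <= M)%N -> star_rep G a b c d ->
  [/\ a + 1 <= M, b + 1 <= M, c + 1 <= M, d + 3 <= M & a + b + c + d = #|G| - 7]%N.
Proof.
move=> gM [phi [phi_real pE]].
have bound (i : 'I_4) : (nth 0%N [:: a; b; c; d] i + (if i == 3 :> nat then 3 else 1) <= M)%N.
  by rewrite -K13_gdeg -pE; exact: leq_trans (realizes_gdeg phi_real i) (gM _).
have := bound (inord 0); have := bound (inord 1); have := bound (inord 2); have := bound (inord 3).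
rewrite !inordK //= => hd hc hb ha; split=> //.
rewrite -(realizes_sum_pendant phi_real K13_skeleton) (eq_bigr _ (fun i _ => pE i)).
by rewrite sum_ord4 !inordK.
Qed.

Lemma path_rep_bounds (G : sgraph) M a b c d : (forall w : G, gdeg w <= M)%N -> path_rep G a b c d ->
  [/\ a + 1 <= M, b + 2 <= M, c + 2 <= M, d + 1 <= M & a + b + c + d = #|G| - 7]%N.
Proof.
move=> gM [phi [phi_real pE]].
have bound (i : 'I_4) : (nth 0%N [:: a; b; c; d] i +
    (if (i == 0 :> nat) || (i == 3 :> nat) then 1 else 2) <= M)%N.
  by rewrite -P4_gdeg -pE; exact: leq_trans (realizes_gdeg phi_real i) (gM _).
have := bound (inord 0); have := bound (inord 1); have := bound (inord 2); have := bound (inord 3).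
rewrite !inordK //= => hd hc hb ha; split=> //.
rewrite -(realizes_sum_pendant phi_real P4_skeleton) (eq_bigr _ (fun i _ => pE i)).
by rewrite sum_ord4 !inordK.
Qed.

(** The lists contain path quadruples up to reversal; for stars they contain sorted leaf counts,
    reached by [star_rep_sort]. *)
Lemma path_among (s : seq (int * int * int * int)) (G : sgraph) a b c d : path_rep G a b c d ->
  ((Posz a, Posz b, Posz c, Posz d) \in s) || ((Posz d, Posz c, Posz b, Posz a) \in s) ->
  giso_among T2 s G.
Proof.
move=> abcd /orP[] abcd_s; [exists a, b, c, d|exists d, c, b, a]; split=> //.
  exact: path_rep_giso.
exact/path_rep_giso/path_rep_rev.
Qed.

Section MinimizerShape.
Variables (R : realType) (s : R) (n : nat) (G : sgraph).
Hypothesis n_ge : (12 <= n)%N.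
Hypothesis s_bnd : 2^-1 <= s < 1.
Hypothesis G_min : A_minimizer s n (n - 4) G.

Lemma minimizer_skeleton :
  ((exists phi : K13 -> G, realizes phi) \/ (exists phi : P4 -> G, realizes phi)) /\
  forall (w : G) (M : nat), (n - 1 <= 4 * M)%N -> (gdeg w <= M)%N.
Proof.
have s_bnd0 : 0 <= s < 1.
  by have /andP[s_ge ->] := s_bnd; rewrite (le_trans _ s_ge) // invr_ge0.
have [l [x [x_gt0 xE l_min]]] := minimizer_Perron s_bnd0 G_min.
have [G_fam _] := G_min; have [cardG G_conn indG] := G_fam.
split; last by move=> w M; exact: (minimizer_gdeg_le s_bnd n_ge x_gt0 xE l_min).
have ind0 : (0 < #|[pred S : {set G} | independent S]|)%N.
  by apply/card_gt0P; exists set0; rewrite inE; apply/forall_inP => u; rewrite inE.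
have [S S_ind S_card] := eq_bigmax_cond (fun S : {set G} => #|S|) ind0.
pose C := ~: S; have C_cover : independent (~: C) by rewrite setCK.
have C_card : #|C| = 4%N.
  have := cardsC S; rewrite cardG -S_card -/(independence_number G) indG -/C.
  by move: n_ge; lia.
have [v0 v0C] : exists v0, v0 \in C by apply/card_gt0P; rewrite C_card.
case: (@arg_minnP _ v0 (mem C) (fun u => gdeg u) v0C) => v vC v_min.
case: (tree_choice G_conn C_cover C_card vC) => -[phi phi_links]; [left|right]; exists phi.
  exact: (minimizer_realizes s_bnd n_ge G_fam x_gt0 xE l_min C_cover C_card vC v_min
    K13_skeleton K13_edge_enum phi_links).
exact: (minimizer_realizes s_bnd n_ge G_fam x_gt0 xE l_min C_cover C_card vC v_min
  P4_skeleton P4_edge_enum phi_links).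
Qed.

Lemma minimizer_quadruple : let M := ((n + 2) %/ 4)%N in
  (exists a b c d, [/\ star_rep G a b c d, (a <= b <= c)%N, (c + 1 <= M)%N,
    (d + 3 <= M)%N & (a + b + c + d = n - 7)%N]) \/
  (exists a b c d, path_rep G a b c d /\
    [/\ a + 1 <= M, b + 2 <= M, c + 2 <= M, d + 1 <= M & a + b + c + d = n - 7]%N).
Proof.
move=> M; have [[cardG _ _] _] := G_min; have [shape gM] := minimizer_skeleton.
have {}gM (w : G) : (gdeg w <= M)%N by apply: gM; rewrite /M; lia.
case: shape => -[phi phi_real]; [left|right].
  have [|a [b [c [abc le_abc]]]] := @star_rep_sort G
      (pendant_nb phi (inord 0)) (pendant_nb phi (inord 1)) (pendant_nb phi (inord 2))
      (pendant_nb phi (inord 3)).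
    by exists phi; split=> //; apply: ord4P; rewrite inordK.
  have [ha hb hc hd] := star_rep_bounds gM abc; rewrite cardG => sumE.
  by exists a, b, c, (pendant_nb phi (inord 3)).
exists (pendant_nb phi (inord 0)), (pendant_nb phi (inord 1)), (pendant_nb phi (inord 2)),
  (pendant_nb phi (inord 3)).
have rep : path_rep G (pendant_nb phi (inord 0)) (pendant_nb phi (inord 1))
    (pendant_nb phi (inord 2)) (pendant_nb phi (inord 3)).
  by exists phi; split=> //; apply: ord4P; rewrite inordK.
by split=> //; have := path_rep_bounds gM rep; rewrite cardG.
Qed.

End MinimizerShape.


(** * Reduction of the lists to a finite computation *)

Lemma quadruple_check (P Q : nat -> nat -> nat -> nat -> bool) :
  all (fun a => all (fun b => all (fun c => all (fun d => Q a b c d ==> P a b c d)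
    (iota 0 6)) (iota 0 6)) (iota 0 6)) (iota 0 6) ->
  forall a b c d, (a < 6)%N -> (b < 6)%N -> (c < 6)%N -> (d < 6)%N -> Q a b c d -> P a b c d.
Proof.
move=> PQ a b c d a6 b6 c6 d6.
move/allP: PQ => /(_ a); rewrite mem_iota a6 => /(_ isT)/allP/(_ b).
rewrite mem_iota b6 => /(_ isT)/allP/(_ c); rewrite mem_iota c6 => /(_ isT)/allP/(_ d).
by rewrite mem_iota d6 => /(_ isT)/implyP.
Qed.

Ltac check_quadruples i j k m Q :=
  match goal with |- is_true ?goal =>
    match eval pattern i, j, k, m in goal with
    | ?P _ _ _ _ => apply: (@quadruple_check P Q _ i j k m); [by vm_compute|lia..]
    end
  end.

(** The smallest listed entry is t - 3. Measured from there, every entry becomes a numeral from 0 to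
    5, and membership in a list no longer mentions [q]. *)
Lemma shift_entry (a q : nat) : (q <= a + 3)%N -> exists2 i : nat, (a + 3 = q + i)%N &
  (((Posz a == Posz q + 1)%R = (i == 4%N)) * ((Posz a == Posz q + 2)%R = (i == 5%N)) *
  ((Posz a == Posz q - 1)%R = (i == 2%N)) * ((Posz a == Posz q - 2)%R = (i == 1%N)) *
  ((Posz a == Posz q - 3)%R = (i == 0%N)) * ((Posz a == Posz q)%R = (i == 3%N)))%type.
Proof. by move=> qa; exists (a + 3 - q)%N; [lia|do ?split; lia]. Qed.

Theorem theorem5p2 (R : realType) (n : nat) (sigma : R) (G : sgraph)
    (hn : (12 <= n)%N) (hsigma : 2^-1 <= sigma < 1)
    (hG : A_minimizer sigma n (n - 4)%N G) :
  let q : nat := ((n - 7) %/ 4)%N in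
  let l : nat := ((n - 7) - 4 * q)%N in
  let t : int := q%:Z in
  [/\ exists a b c d : nat,
        (a + b + c + d)%N = (n - 7)%N /\
        (giso G (T1 a b c d) \/ giso G (T2 a b c d)),
      l = 0%N ->
        giso_among T1
          [:: (t - 1, t + 1, t + 1, t - 1); (t, t + 1, t + 1, t - 2);
              (t, t, t + 1, t - 1); (t + 1, t + 1, t + 1, t - 3)] G \/
        giso_among T2
          [:: (t - 1, t, t, t + 1); (t, t - 1, t, t + 1);
              (t, t, t - 1, t + 1); (t, t, t, t);
              (t + 1, t - 2, t, t + 1); (t + 1, t - 1, t - 1, t + 1)] G,
      l = 1%N ->
        giso_among T1
          [:: (t, t + 1, t + 1, t - 1); (t + 1, t + 1, t + 1, t - 2)] G \/
        giso_among T2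
          [:: (t, t, t, t + 1); (t + 1, t - 1, t, t + 1)] G,
      l = 2%N ->
        giso_among T1 [:: (t + 1, t + 1, t + 1, t - 1)] G \/
        giso_among T2 [:: (t + 1, t, t, t + 1)] G
    & l = 3%N ->
        giso_among T1
          [:: (t - 1, t + 2, t + 2, t); (t, t + 2, t + 2, t - 1);
              (t, t + 1, t + 2, t); (t + 1, t + 2, t + 2, t - 2);
              (t + 1, t + 1, t + 2, t - 1); (t + 1, t + 1, t + 1, t);
              (t + 2, t + 2, t + 2, t - 3)] G \/
        giso_among T2
          [:: (t - 1, t + 1, t + 1, t + 2); (t, t, t + 1, t + 2);
              (t, t + 1, t, t + 2); (t, t + 1, t + 1, t + 1);
              (t + 1, t + 1, t - 1, t + 2); (t + 1, t - 1, t + 1, t + 2);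
              (t + 1, t, t, t + 2); (t + 1, t, t + 1, t + 1);
              (t + 2, t - 2, t + 1, t + 2); (t + 2, t - 1, t, t + 2)] G].

Proof.
move=> q l t; have [[a [b [c [d [rep]]]]]|[a [b [c [d [rep]]]]]] := minimizer_quadruple hn hsigma hG.
{ move=> /andP[ab bc] hc hd sumE; have iso := star_rep_giso rep.
  split; first by exists a, b, c, d; split=> //; left.
  all: move=> l_eq; left; exists a, b, c, d; split=> //; rewrite !inE !xpair_eqE /t.
  all: have nE : (n - 7 = 4 * q + l)%N by rewrite /l /q; lia.
  all: have ME : ((n + 2) %/ 4 = q + 2 + (l == 3))%N
    by rewrite l_eq /=; move: nE; rewrite l_eq; lia.
  all: move: sumE hc hd; rewrite nE ME l_eq /=; clear -ab bc; clearbody q => sumE hc hd.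
  (* The upper bounds on three entries and the value of the sum keep the fourth at least q - 3. *)
  all: have [|i aE ai] := @shift_entry a q; first by lia.
  all: have [|j bE bj] := @shift_entry b q; first by lia.
  all: have [|k cE ck] := @shift_entry c q; first by lia.
  all: have [|m dE dm] := @shift_entry d q; first by lia.
  all: rewrite !ai !bj !ck !dm.
  (* The degree bound is q + 2, or q + 3 in the last class. Tree degrees 1 and 3 and the shift by 3
     give the bounds 4 and 2, or 5 and 3; the sum becomes 12 plus the residue. *)
  1: check_quadruples i j k m (fun i j k m =>
    [&& i <= j, j <= k, k <= 4, m <= 2 & i + j + k + m == 12]%N).
  1: check_quadruples i j k m (fun i j k m =>
    [&& i <= j, j <= k, k <= 4, m <= 2 & i + j + k + m == 13]%N).
  1: check_quadruples i j k m (fun i j k m =>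
    [&& i <= j, j <= k, k <= 4, m <= 2 & i + j + k + m == 14]%N).
  check_quadruples i j k m (fun i j k m =>
    [&& i <= j, j <= k, k <= 5, m <= 3 & i + j + k + m == 15]%N). }
move=> [ha hb hc hd sumE]; split.
  by exists a, b, c, d; split=> //; right; exact: path_rep_giso.
all: move=> l_eq; right; apply: (path_among rep); rewrite !inE !xpair_eqE /t.
all: have nE : (n - 7 = 4 * q + l)%N by rewrite /l /q; lia.
all: have ME : ((n + 2) %/ 4 = q + 2 + (l == 3))%N
  by rewrite l_eq /=; move: nE; rewrite l_eq; lia.
all: move: sumE ha hb hc hd; rewrite nE ME l_eq /=; clear; clearbody q => sumE ha hb hc hd.
all: have [|i aE ai] := @shift_entry a q; first by lia.
all: have [|j bE bj] := @shift_entry b q; first by lia.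
all: have [|k cE ck] := @shift_entry c q; first by lia.
all: have [|m dE dm] := @shift_entry d q; first by lia.
all: rewrite !ai !bj !ck !dm.
1: check_quadruples i j k m (fun i j k m =>
  [&& i <= 4, j <= 3, k <= 3, m <= 4 & i + j + k + m == 12]%N).
1: check_quadruples i j k m (fun i j k m =>
  [&& i <= 4, j <= 3, k <= 3, m <= 4 & i + j + k + m == 13]%N).
1: check_quadruples i j k m (fun i j k m =>
  [&& i <= 4, j <= 3, k <= 3, m <= 4 & i + j + k + m == 14]%N).
check_quadruples i j k m (fun i j k m =>
  [&& i <= 5, j <= 4, k <= 4, m <= 5 & i + j + k + m == 15]%N).
Qed.
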